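(* Let $(X,\mu)$ and $(Y,\nu)$ be two Polish probability measure spaces. Suppose that the cost function $c:X\times Y\to\mathbb{R}$ is lower semicontinuous and that $c(x,y)\ge a(x)+b(y)$ for all $(x,y)\in X\times Y$, for some upper semicontinuous functions $a\in L_1(\mu)$ and $b\in L_1(\nu)$. Assume that the optimal total cost $C(\mu,\nu)$ is finite. Let $\pi\in\Pi(\mu,\nu)$ be an optimal transport plan, and let $f:X\to(-\infty,+\infty]$ be a $-c$-convex function such that $\pi$ is concentrated on $G(\partial_{-c}f)$. Let $\tilde\pi$ be a measure on $X\times Y$ satisfying $\tilde\pi\le\pi$ and $\zeta:=\tilde\pi[X\times Y]>0$; let $\pi':=\tilde\pi/\zeta$, and let $\mu'$ and $\nu'$ be the marginals of $\pi'$ on $X$ and $Y$, respectively. Let $X'\subset X$ be a closed set containing the support of $\mu'$, let $Y'\subset Y$ be a closed set containing the support of $\nu'$, and let $c'$ be the restriction of $c$ to $X'\times Y'$. Let $M:X'\rightrightarrows Y'$ be any (multivalued) mapping such that $\pi'$ is concentrated on $G(M)$ and $G(M)\subset G(\partial_{-c}f)\cap(X'\times Y')$. Let $\emptyset\neq S\subset\mathrm{dom}(M)$. Then $\mathcal{A}_{[-c',f|_S,M]}$ is the family of $-c'$-convex functions $f':X'\to(-\infty,+\infty]$ such that (a) $f'$ coincides with $f$ on $S$, and $\mathrm{dom}(f')$ has full $\mu'$-measure; (b) $f'$ is a $-c'$-antiderivative of $M$ and, in particular, $\pi'$ is concentrated on $G(\partial_{-c'}f')$; (c) $f'$ solves the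 dual Kantorovich problem between $(X',\mu')$ and $(Y',\nu')$ with cost $c'$. Furthermore, $\mathcal{A}_{[-c',f|_S,M]}$ is not empty. In particular, $\alpha_{[-c',f|_S,M]}$ and $\gamma_{[-c',f|_S,M]}$ are, respectively, the minimal and the maximal $-c'$-convex functions with these properties. The function $\alpha_{[-c',f|_S,M]}$ is given explicitly by $$\alpha_{[-c',f|_S,M]}(x)=\sup_{s\in S}\,\big[f(s)+R_{[-c',M,s]}(x)\big]\qquad\text{for all }x\in X',$$ and $\gamma_{[-c',f|_S,M]}$ is given via $$\gamma_{[-c',f|_S,M]}^{\,-c'}=\alpha_{[-c',f^{-c}|_{M(S)},M^{-1}]},\qquad\text{that is,}\qquad \gamma_{[-c',f|_S,M]}=\big(\alpha_{[-c',f^{-c}|_{M(S)},M^{-1}]}\big)^{-c'}.$$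
   Context: Transport. $\Pi(\mu,\nu)$ is the set of probability measures on $X\times Y$ with marginals $\mu$ on $X$ and $\nu$ on $Y$ (transport plans). The optimal total cost is $C(\mu,\nu):=\inf_{\pi\in\Pi(\mu,\nu)}\int_{X\times Y}c\,d\pi$, and a plan attaining the infimum is an optimal transport plan. A measure is concentrated on a set if the complement of that set is negligible (contained in a null set); a set has full measure if its complement is negligible. $k$-convexity. Let $A,B$ be nonempty sets and $k:A\times B\to\mathbb{R}$ a function (below, $k$ is $-c$ on $X\times Y$ or $-c'$ on $X'\times Y'$). - A function $h:A\to(-\infty,+\infty]$ is proper if $\mathrm{dom}(h):=\{x: h(x)<\infty\}\ne\emptyset$. - The $k$-transform of $h:A\to[-\infty,\infty]$ is $h^k:B\to[-\infty,\infty]$, $h^k(y):=\sup_{x\in A}[k(x,y)-h(x)]$. The $k$-transform of $g:B\to[-\infty,\infty]$ is $g^k:A\to[-\infty,\infty]$, $g^k(x):=\sup_{y\in B}[k(x,y)-g(y)]$. - A proper function $h:A\to(-\infty,+\infty]$ is $k$-convex if $h=g^k$ for some $g:B\to(-\infty,+\infty]$. Symmetrically, a proper function $g:B\to(-\infty,+\infty]$ is $k$-convex if $g=h^k$ for some $h:A\to(-\infty,+\infty]$. - For a multivalued mapping $M:A\rightrightarrows B$: $G(M):=\{(x,y): y\in M(x)\}$, $\mathrm{dom}(M):=\{x: M(x)\neq\emptyset\}$, $M(S):=\bigcup_{s\in S}M(s)$, and $M^{-1}:B\rightrightarrows A$ is given by $M^{-1}(y)=\{x: y\in M(x)\}$.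 - The $k$-subdifferential of a proper $h:A\to(-\infty,+\infty]$ is the mapping $\partial_k h:A\rightrightarrows B$, $$\partial_k h(x):=\{y\in B: h(x)+k(x',y)\le h(x')+k(x,y)\ \ \forall x'\in A\}=\{y\in B: h(x)+h^k(y)=k(x,y)\}.$$ For proper $g:B\to(-\infty,+\infty]$, $\partial_k g:B\rightrightarrows A$ is defined in the same way with the roles of $A$ and $B$ exchanged. - $h$ is a $k$-antiderivative of $M$ if $G(M)\subset G(\partial_k h)$. The families. $\mathcal{A}_{[-c',f|_S,M]}$ is the set of all $-c'$-convex $h:X'\to(-\infty,+\infty]$ with $G(M)\subset G(\partial_{-c'}h)$ and $h|_S=f|_S$. Its lower and upper envelopes are $$\alpha_{[-c',f|_S,M]}(x):=\inf\{h(x): h\in\mathcal{A}_{[-c',f|_S,M]}\},\qquad \gamma_{[-c',f|_S,M]}(x):=\sup\{h(x): h\in\mathcal{A}_{[-c',f|_S,M]}\}.$$ Dually, $\mathcal{A}_{[-c',f^{-c}|_{M(S)},M^{-1}]}$ is the set of all $-c'$-convex $h:Y'\to(-\infty,+\infty]$ with $G(M^{-1})\subset G(\partial_{-c'}h)$ and $h|_{M(S)}=f^{-c}|_{M(S)}$, and $\alpha_{[-c',f^{-c}|_{M(S)},M^{-1}]}$ is the pointwise infimum over this family. Rockafellar's function. For $s\in\mathrm{dom}(M)$, $R_{[k,M,s]}:A\to(-\infty,+\infty]$ is $$R_{[k,M,s]}(x):=\sup\Big\{\sum_{i=1}^n[k(x_{i+1},y_i)-k(x_i,y_i)]\ :\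 n\in\mathbb{N},\ x_1=s,\ x_{n+1}=x,\ \{(x_i,y_i)\}_{i=1}^n\subset G(M)\Big\}.$$ Dual Kantorovich problem. The dual problem between $(X',\mu')$ and $(Y',\nu')$ with cost $c'$ is the problem of attaining the supremum $$\sup\Big\{\int_{Y'}g\,d\nu'-\int_{X'}h\,d\mu'\ :\ h\in L_1(\mu'),\ g\in L_1(\nu'),\ g(y)-h(x)\le c'(x,y)\ \ \forall (x,y)\in X'\times Y'\Big\}=\sup_{h\in L_1(\mu')}\Big(-\int_{Y'}h^{-c'}\,d\nu'-\int_{X'}h\,d\mu'\Big),$$ which by Kantorovich duality equals $C(\mu',\nu')=\min_{\rho\in\Pi(\mu',\nu')}\int_{X'\times Y'}c'\,d\rho$. A $-c'$-convex function $f'$ solves this problem if the pair $(h,g)=(f',-(f')^{-c'})$ attains the supremum, that is, $-\int_{Y'}(f')^{-c'}\,d\nu'-\int_{X'}f'\,d\mu'=C(\mu',\nu')$.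
   Formalization: In (c), f' need not be integrable, so the printed claim can fail; it is proved that −(f')^{-c'}(y)−f'(x) integrates to C(μ',ν') against an optimal plan, and the dual equality as printed holds whenever f' and (f')^{-c'} are integrable. *)

(* Defs.v *)
From HB Require Import structures.
From mathcomp Require Import all_boot all_order all_algebra.
From mathcomp Require Import all_classical all_reals all_analysis.

Set Implicit Arguments.
Unset Strict Implicit.
Unset Printing Implicit Defensive.

Import Order.TTheory GRing.Theory Num.Theory.
Import numFieldNormedType.Exports.

Local Open Scope classical_set_scope.
Local Open Scope ring_scope.
Local Open Scope ereal_scope.

(* A Polish space is presented by a complete separable metric: Hausdorff
   turns the pseudometric into a metric. Nothing below uses the metric itself,
   only its topology. *)
Definition polish (R : realType) (X : completePseudoMetricType R) : Prop :=
  hausdorff_space X /\ exists2 D : set X, countable D & dense D.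

Definition borel (X : ptopologicalType) := g_sigma_algebraType (@open X).

Definition upper_semicontinuous (R : realType) (X : topologicalType)
    (f : X -> \bar R) : Prop := lower_semicontinuous (fun x => - f x).

Definition msupport (R : realType) (X : ptopologicalType)
    (mu : set (borel X) -> \bar R) : set X :=
  [set x | forall U : set X, open U -> U x -> 0 < mu U].

Definition concentrated (R : realType) (d : measure_display)
    (T : measurableType d) (mu : set T -> \bar R) (E : set T) : Prop :=
  mu.-negligible (~` E).

(* [h] is integrable on [D] for the completion of [mu], with integral [v]:
   [h] has an integrable version. *)
Definition has_integral (R : realType) (d : measure_display)
    (T : measurableType d) (mu : set T -> \bar R) (D : set T)
    (h : T -> \bar R) (v : \bar R) : Prop :=
  exists h0 : T -> \bar R,
    [/\ mu.-integrable D h0,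
        mu.-negligible [set x | D x /\ h x <> h0 x] &
        \int[mu]_(x in D) h0 x = v].

(* A map [M : A -> B] with set values is a function [T -> set U]
   whose graph lies in [A `*` B]. *)
Section multivalued.
Context {T U : Type}.
Implicit Types M : T -> set U.

Definition graph M : set (T * U) := [set z | M z.1 z.2].
Definition mdom M : set T := [set x | M x !=set0].
Definition mimage M (S : set T) : set U := \bigcup_(s in S) M s.
Definition minv M : U -> set T := fun y => [set x | M x y].
End multivalued.

Definition flip_kernel (R : Type) (T U : Type) (k : T -> U -> R) : U -> T -> R :=
  fun y x => k x y.

(* The nonempty sets [A] and [B] on which [k] and the functions live are subsets
   of ambient types; values of functions outside them are irrelevant, since every
   condition, supremum and integral is relativized. Statements about functions on
   [B] are obtained by exchanging [A] and [B] and flipping [k]. *)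
Section kconvexity.
Context {R : realType} {T U : Type}.
Implicit Types (A : set T) (B : set U) (k : T -> U -> R) (h : T -> \bar R).

Definition effdom A h : set T := [set x | A x /\ h x < +oo].

Definition proper_fun A h : Prop :=
  (forall x, A x -> h x != -oo) /\ effdom A h !=set0.

Definition ktransform A k h : U -> \bar R :=
  fun y => ereal_sup [set (k x y)%:E - h x | x in A].

Definition subdiff A B k h : T -> set U :=
  fun x => [set y | [/\ A x, B y &
    forall x', A x' -> h x + (k x' y)%:E <= h x' + (k x y)%:E]].

Definition antiderivative A B k (M : T -> set U) h : Prop :=
  graph M `<=` graph (subdiff A B k h).

(* The [n >= 1] pairs of the chain are [(xs i, ys i)], [i < n]. *)
Definition rockafellar k (M : T -> set U) (s x : T) : \bar R :=
  ereal_sup [set v | exists (n : nat) (xs : nat -> T) (ys : nat -> U),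
    [/\ (0 < n)%N, xs 0%N = s, xs n = x,
        forall i, (i < n)%N -> graph M (xs i, ys i) &
        v = (\sum_(0 <= i < n) (k (xs i.+1) (ys i) - k (xs i) (ys i))%R)%:E]].

Definition lower_envelope (F : set (T -> \bar R)) : T -> \bar R :=
  fun x => ereal_inf [set h x | h in F].

Definition upper_envelope (F : set (T -> \bar R)) : T -> \bar R :=
  fun x => ereal_sup [set h x | h in F].

End kconvexity.

Definition kconvex (R : realType) (T U : Type) (A : set T) (B : set U)
    (k : T -> U -> R) (h : T -> \bar R) : Prop :=
  proper_fun A h /\
  exists g : U -> \bar R, (forall y, B y -> g y != -oo) /\
    forall x, A x -> h x = ktransform B (flip_kernel k) g x.

Definition antider_family (R : realType) (T U : Type) (A : set T) (B : set U)
    (k : T -> U -> R) (S : set T) (f0 : T -> \bar R) (M : T -> set U) :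
    set (T -> \bar R) :=
  [set h | [/\ kconvex A B k h, antiderivative A B k M h &
              forall s, S s -> h s = f0 s]].

Definition neg_cost (R : realType) (T U : Type) (c : T * U -> R) : T -> U -> R :=
  fun x y => (- c (x, y))%R.

(* Measures on closed sets [A] and [B] of full measure are identified with their
   extensions by 0 to the ambient spaces. *)
Section transport.
Context {R : realType} {d1 d2 : measure_display}.
Context {T : measurableType d1} {U : measurableType d2}.
Implicit Types (mu : probability T R) (nu : probability U R).
Implicit Types (A : set T) (B : set U) (c : T * U -> R).

Definition plans mu nu : set (probability (T * U)%type R) :=
  [set rho | (forall E, measurable E -> rho (E `*` [set: U]) = mu E) /\
             (forall F, measurable F -> rho ([set: T] `*` F) = nu F)].

Definition transport_cost mu nu A B c : \bar R :=
  ereal_inf [set \int[rho]_(z in A `*` B) (c z)%:E | rho in plans mu nu].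

Definition optimal_plan mu nu A B c : set (probability (T * U)%type R) :=
  [set rho | plans mu nu rho /\
     \int[rho]_(z in A `*` B) (c z)%:E = transport_cost mu nu A B c].

Definition dual_admissible A B c (h : T -> \bar R) (g : U -> \bar R) : Prop :=
  [/\ forall x, A x -> h x != -oo, forall y, B y -> g y != +oo &
      forall x y, A x -> B y -> g y - h x <= (c (x, y))%:E].

Definition dual_value mu nu A B c : \bar R :=
  ereal_sup [set w | exists (h : T -> \bar R) (g : U -> \bar R) (u v : \bar R),
    [/\ dual_admissible A B c h g, has_integral mu A h u,
        has_integral nu B g v & w = v - u]].

(* [h] solves the dual problem through the pair [(h, - h^{-c})]. If both
   functions are integrable this says that the pair attains the supremum, with
   value the optimal cost. In general they need be neither integrable nor
   measurable, and [- \int h^{-c} - \int h] may be undefined: take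
   [c (x, y) = `|h x - h y|], with [mu = nu], the diagonal plan and [h]
   continuous but not integrable, so that [h^{-c} = - h]. The two
   integrals are then combined into the integral of [- h^{-c}(y) - h(x)]
   against an optimal plan. *)
Definition solves_dual mu nu A B c (h : T -> \bar R) : Prop :=
  let hc := ktransform A (neg_cost c) h in
  [/\ dual_admissible A B c h (fun y => - hc y),
      exists2 rho, optimal_plan mu nu A B c rho &
        has_integral rho (A `*` B) (fun z => - hc z.2 - h z.1)
          (transport_cost mu nu A B c) &
      forall u v, has_integral mu A h u -> has_integral nu B hc v ->
        - v - u = dual_value mu nu A B c /\
        - v - u = transport_cost mu nu A B c].

End transport.

(* Main.v *)
(** The family is governed by chains: a function with the prescribed subgradients
    grows along a chain of [M] starting at [s] at least as much as the chain sum,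
    which makes [sup_s (f s + R_s)] the least member; the k-transform is an order
    reversing bijection between the family and its dual, which turns the least
    member of the dual family into the greatest one here.

    Any member [h] satisfies [- h^k(y) - h(x) = c(x, y)] on the graph of its
    subdifferential, hence [pi']-almost everywhere, so the integral of [c] against
    [pi'] bounds the dual problem by weak duality and is attained by [h]: the
    Kantorovich duality theorem is not needed.
    That [pi'] is optimal follows by perturbing [pi]: replacing its part [pit] by
    the rescaled competitor [zeta rho] gives a plan between [mu] and [nu].

    The effective domain of [h] contains the projection of the graph of [M], which
    need not be measurable; inner regularity of [pi'] by compact sets provides
    a sigma-compact subset of full measure. *)

Require Import Defs.
From HB Require Import structures.
From mathcomp Require Import all_boot all_order all_algebra.
From mathcomp Require Import all_classical all_reals all_analysis.
From mathcomp Require Import measurable_realfun lra.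

Set Implicit Arguments.
Unset Strict Implicit.
Unset Printing Implicit Defensive.

Import Order.TTheory GRing.Theory Num.Theory.
Import numFieldNormedType.Exports.

Local Open Scope classical_set_scope.
Local Open Scope ring_scope.
Local Open Scope ereal_scope.

(** * k-convex functions and their transforms *)

(** No indeterminate form arises because [r] is finite. This symmetry in [a] and [b] is what makes
    the two k-transforms a Galois connection. *)
Lemma leeB_swap (R : realDomainType) (r : R) (a b : \bar R) :
  (r%:E - a <= b) = (r%:E - b <= a).
Proof.
case: a => [a| |]; case: b => [b| |]; rewrite ?leNye ?leey -?EFinB ?lee_fin //.
by rewrite !lerBlDr addrC.
Qed.

Section ktransform.
Context {R : realType} {T U : Type}.
Implicit Types (A : set T) (B : set U) (k : T -> U -> R) (h : T -> \bar R).

Lemma ktransform_ge A k h x y : A x -> (k x y)%:E - h x <= ktransform A k h y.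
Proof. by move=> Ax; apply: ereal_sup_ubound; exists x. Qed.

Lemma ktransform_leP A k h y u :
  (forall x, A x -> (k x y)%:E - h x <= u) -> ktransform A k h y <= u.
Proof. by move=> hu; apply: ge_ereal_sup => _ [x Ax <-]; exact: hu. Qed.

Lemma ktransform_anti A k h1 h2 y : (forall x, A x -> h1 x <= h2 x) ->
  ktransform A k h2 y <= ktransform A k h1 y.
Proof.
move=> h12; apply: ktransform_leP => x Ax.
by apply: le_trans (ktransform_ge k h1 y Ax); apply: leeB => //; exact: h12.
Qed.

Lemma eq_ktransform A k h1 h2 y : (forall x, A x -> h1 x = h2 x) ->
  ktransform A k h1 y = ktransform A k h2 y.
Proof.
by move=> h12; apply/eqP; rewrite eq_le !ktransform_anti// => x Ax; rewrite h12.
Qed.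

End ktransform.

Section ktransformK.
Context {R : realType} {T U : Type}.
Implicit Types (A : set T) (B : set U) (k : T -> U -> R) (h : T -> \bar R).

Lemma ktransformK_le A B k h x : A x ->
  ktransform B (flip_kernel k) (ktransform A k h) x <= h x.
Proof.
by move=> Ax; apply: ktransform_leP => y By; rewrite leeB_swap; exact: ktransform_ge.
Qed.

End ktransformK.

Section kconvexK.
Context {R : realType} {T U : Type}.
Implicit Types (A : set T) (B : set U) (k : T -> U -> R) (h : T -> \bar R).

(** Write [h] as the transform of some [g]. The double transform of [g] lies below [g], so the
    transform of [h] does, and transforming once more reverses the order. *)
Lemma kconvexK A B k h x : kconvex A B k h -> A x ->
  ktransform B (flip_kernel k) (ktransform A k h) x = h x.
Proof.
move=> [_ [g [_ hg]]] Ax; apply/eqP; rewrite eq_le ktransformK_le//= hg//.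
apply: ktransform_anti => y By.
rewrite (eq_ktransform k y hg).
exact: (@ktransformK_le _ _ _ B A (flip_kernel k)).
Qed.

Lemma ktransform_neqNy A k h y : proper_fun A h -> ktransform A k h y != -oo.
Proof.
move=> [hN [x [Ax hx]]].
have : (k x y)%:E - h x <= ktransform A k h y by exact: ktransform_ge.
by have := hN _ Ax; case: (h x) hx => // r _ _; rewrite -ltNye; apply: lt_le_trans; rewrite ltNyr.
Qed.

End kconvexK.

Section ksubdifferential.
Context {R : realType} {T U : Type}.
Implicit Types (A : set T) (B : set U) (k : T -> U -> R) (h : T -> \bar R).

(** Subgradients are the points where the transform inequality is an equality. Testing the defining
    inequality at a point of the effective domain shows that [h x] is finite, so that terms may be
    moved freely. *)
Lemma subdiffP A B k h x y : proper_fun A h ->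
  subdiff A B k h x y <-> [/\ A x, B y, h x \is a fin_num &
    ktransform A k h y = (k x y)%:E - h x].
Proof.
move=> [hN [x0 [Ax0 hx0]]]; split=> [[Ax By hxy]|[Ax By hfin hk]].
  have hfin : h x \is a fin_num.
    have := hxy _ Ax0; have := hN _ Ax; have := hN _ Ax0.
    by case: (h x) => //; case: (h x0) hx0.
  split => //; apply/eqP; rewrite eq_le ktransform_ge// andbT.
  apply: ktransform_leP => x' Ax'.
  have := hxy _ Ax'; have := hN _ Ax'; case: (h x) hfin => // r _.
  case: (h x') => [r'| |] // _; last by rewrite leNye.
  by rewrite -!EFinB -!EFinD !lee_fin => ?; lra.
split=> // x' Ax'.
have := ktransform_ge k h y Ax'; rewrite hk.
have := hN _ Ax'; case: (h x) hfin => // r _.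
case: (h x') => [r'| |] // _; last by rewrite leey.
by rewrite -!EFinB -!EFinD !lee_fin => ?; lra.
Qed.

Lemma subdiff_ktransform A B k h x y : proper_fun A h ->
  subdiff A B k h x y ->
  subdiff B A (flip_kernel k) (ktransform A k h) y x.
Proof.
move=> hp /(subdiffP _ _ _ _ hp)[Ax By hfin hk]; split=> // y' By'.
have := ktransform_ge k h y' Ax; rewrite hk /flip_kernel.
case: (h x) hfin => // r _; case: (ktransform A k h y') => [s| |] //.
  by rewrite -!EFinB -!EFinD !lee_fin => ?; lra.
by rewrite addye// !leey.
Qed.

(** On the graph of [M] the value of [h] at one coordinate determines that of its transform at the
    other. The set [S'] is left general so that the lemma also serves for the way back, from [M(S)]
    to [S]; there the inverse image of [M(S)] may exceed [S], hence the premise [S' y] in the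
    compatibility condition. *)
Lemma antider_family_ktransform A B k S S' f0 (g0 : U -> \bar R) M h :
  graph M !=set0 -> S' `<=` mimage M S ->
  (forall s y, S s -> M s y -> S' y -> g0 y = (k s y)%:E - f0 s) ->
  antider_family A B k S f0 M h ->
  antider_family B A (flip_kernel k) S' g0 (minv M) (ktransform A k h).
Proof.
move=> [[x1 y1] M1] S'M fg [[hp hc] hM hS]; split.
- split; last by exists h; split=> //; exact: hp.1.
  split=> [y By|]; first exact: ktransform_neqNy.
  have /(subdiffP _ _ _ _ hp)[_ By1 hfin hk1] := hM _ M1.
  by exists y1; split=> //=; rewrite hk1; case: (h x1) hfin => // r _; rewrite ltry.
- by move=> [y x] /= Mxy; apply: subdiff_ktransform => //; exact: (hM (x, y)).
- move=> y S'y; have [s Ss Msy] := S'M _ S'y.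
  have /(subdiffP _ _ _ _ hp)[_ _ _ ->] := hM _ (Msy : graph M (s, y)).
  by rewrite (fg s) ?hS.
Qed.

End ksubdifferential.

(** * Chains of a multivalued map and Rockafellar's function *)

Section chains.
Context {R : realType} {T U : Type}.
Variables (A : set T) (B : set U) (k : T -> U -> R) (M : T -> set U).
Implicit Types (h : T -> \bar R).

(** The chain has [n.+1] pairs. Its last increment is split off, since it alone depends on the
    endpoint [x], which may then vary with the rest of the chain fixed. *)
Lemma rockafellar_chain (n : nat) xs ys x : (forall i, (i <= n)%N -> M (xs i) (ys i)) ->
  (\sum_(0 <= i < n) (k (xs i.+1) (ys i) - k (xs i) (ys i)) +
    (k x (ys n) - k (xs n) (ys n)))%:E <= rockafellar k M (xs 0%N) x.
Proof.
move=> Mi; apply: ereal_sup_ubound.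
exists n.+1, (fun i => if (i <= n)%N then xs i else x), ys; split => //.
- by rewrite ltnn.
- by move=> i; rewrite ltnS => iln; rewrite iln; exact: Mi.
congr EFin; rewrite big_nat_recr//= ltnn leqnn; congr (_ + _)%R.
by apply: eq_big_nat => i /andP[_ ltin]; rewrite ltin (ltnW ltin).
Qed.

Lemma rockafellar_ge s y x : M s y -> (k x y - k s y)%:E <= rockafellar k M s x.
Proof.
move=> Msy; have := @rockafellar_chain 0%N (fun=> s) (fun=> y) x (fun _ _ => Msy).
by rewrite big_geq// add0r.
Qed.

(** A chain ending at [x] is prolonged by the pair [(x, y)] and then ends at [x']. *)
Lemma rockafellar_step s x y x' : M x y ->
  rockafellar k M s x + (k x' y - k x y)%:E <= rockafellar k M s x'.
Proof.
move=> Mxy; rewrite -leeBrDr//; apply: ge_ereal_sup => _ [n [xs [ys [n0 <- xsn Mi ->]]]].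
rewrite leeBrDr//.
pose ys' i := if (i < n)%N then ys i else y.
have Mi' i : (i <= n)%N -> M (xs i) (ys' i).
  rewrite /ys' leq_eqVlt => /predU1P[->|lin]; first by rewrite ltnn xsn.
  by rewrite lin; exact: Mi.
have ys'n : ys' n = y by rewrite /ys' ltnn.
have := rockafellar_chain x' Mi'; rewrite ys'n xsn EFinD.
apply: le_trans; rewrite leeD2r// lee_fin le_eqVlt; apply/orP; left; apply/eqP.
by apply: eq_big_nat => i /andP[_ ltin]; rewrite /ys' ltin.
Qed.

Lemma antiderivative_rockafellar h s x : proper_fun A h ->
  antiderivative A B k M h -> A x -> mdom M s ->
  h s + rockafellar k M s x <= h x.
Proof.
move=> hp hM Ax [y Msy].
have /(subdiffP _ _ _ _ hp)[_ _ hs _] := hM _ (Msy : graph M (s, y)).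
rewrite addeC -leeBrDr//; apply: ge_ereal_sup => _ [n [xs [ys [n0 xs0 xsn Mi ->]]]].
rewrite leeBrDr// -xs0 -xsn addeC.
(* Induction on the length, adding one subgradient inequality per pair. Only the endpoint needs this
   hypothesis: the earlier points lie in [A] because they belong to pairs of the graph. *)
have Axn : A (xs n) by rewrite xsn.
elim: n {n0 xsn} Mi Axn => [|n IH] Mi Axn; first by rewrite big_geq// adde0.
have /(subdiffP _ _ _ _ hp)[Axn' _ hn hk] := hM _ (Mi _ (ltnSn n)).
have {}IH := IH (fun i li => Mi i (leqW li)) Axn'.
rewrite big_nat_recr//= EFinD addeA.
have := ktransform_ge k h (ys n) Axn; rewrite hk /= => hle.
apply: (le_trans (leeD2r _ IH)); move: hle.
case: (h (xs n)) hn => // r _; case: (h (xs n.+1)) => [q| |] //.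
  by rewrite -!EFinB -!EFinD !lee_fin => ?; lra.
by rewrite leey.
Qed.

End chains.

(** * The least and the greatest member of the family *)

Section envelopes.
Context {R : realType} {T U : Type}.
Variables (A : set T) (B : set U) (k : T -> U -> R) (S : set T) (f0 : T -> \bar R).
Variable M : T -> set U.
Implicit Types (h : T -> \bar R).
Local Notation F := (antider_family A B k S f0 M).

Lemma graph_antider_family h x y : F h -> M x y ->
  [/\ A x, B y, h x \is a fin_num & ktransform A k h y = (k x y)%:E - h x].
Proof. by move=> [[hp _] hM _] Mxy; apply/(subdiffP _ _ _ _ hp)/(hM (x, y)). Qed.

(** Membership depends on the values on [A] only, and it is only there that the lower envelope will
    be identified with Rockafellar's formula. *)
Lemma eq_antider_family h1 h2 : S `<=` A -> (forall x, A x -> h1 x = h2 x) ->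
  F h1 -> F h2.
Proof.
move=> SA h12 [[[h1N [x [Ax h1x]]] [g [gN h1g]]] h1M h1S]; split.
- split; last by exists g; split=> // y Ay; rewrite -h12// h1g.
  split=> [y Ay|]; first by rewrite -h12//; exact: h1N.
  by exists x; split=> //; rewrite -h12.
- move=> z /h1M[Az1 Bz2 hz]; split=> // x' Ax'.
  by rewrite -!h12//; exact: hz.
- by move=> s Ss; rewrite -h12; [exact: h1S|exact: SA].
Qed.

Hypotheses (F0 : F !=set0) (S0 : S !=set0) (S_dom : S `<=` mdom M).

Let S_A : S `<=` A.
Proof.
have [h Fh] := F0.
by move=> s /S_dom[y Msy]; have [] := graph_antider_family Fh Msy.
Qed.

Let f0_fin s : S s -> f0 s \is a fin_num.
Proof.
have [h Fh] := F0; have [_ _ hS] := Fh.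
by move=> Ss; have [y Msy] := S_dom Ss; have [_ _] := graph_antider_family Fh Msy; rewrite hS.
Qed.

Let H x := ereal_sup [set f0 s + rockafellar k M s x | s in S].

Lemma rockafellar_lower_bound h x : F h -> A x -> H x <= h x.
Proof.
move=> [[hp _] hM hS] Ax; apply: ge_ereal_sup => _ [s Ss <-].
by rewrite -hS//; apply: antiderivative_rockafellar hp hM Ax (S_dom Ss).
Qed.

Let le_H s x : S s -> f0 s + rockafellar k M s x <= H x.
Proof. by move=> Ss; apply: ereal_sup_ubound; exists s. Qed.

Let H_S s : S s -> H s = f0 s.
Proof.
move=> Ss; have [h Fh] := F0; have [_ _ hS] := Fh.
apply/eqP; rewrite eq_le -{1}hS// rockafellar_lower_bound//; last exact: S_A.
(* The one-pair chain from [s] back to [s] has sum zero, so Rockafellar's function is nonnegative at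
   its base point. *)
have [y Msy] := S_dom Ss; rewrite (le_trans _ (le_H s Ss))// leeDl//.
by have := rockafellar_ge k s Msy; rewrite subrr.
Qed.

Let H_proper : proper_fun A H.
Proof.
have [s Ss] := S0; split.
  move=> x Ax; have [y Msy] := S_dom Ss.
  rewrite -ltNye (lt_le_trans _ (le_H x Ss))//.
  rewrite (lt_le_trans _ (leeD2l _ (rockafellar_ge k x Msy)))//.
  by have := f0_fin Ss; case: (f0 s) => // r _; rewrite ltNyr.
exists s; split; first exact: S_A.
by rewrite H_S// ltey_eq f0_fin.
Qed.

(** As a function of its endpoint [x], a chain value is [k x y] plus a constant, where [y] closes
    the chain; a supremum of such functions is k-convex. *)
Lemma rockafellar_antider_family : F H.
Proof.
split; last exact: H_S.
- split=> //; exists (ktransform A k H); split=> [y By|x Ax].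
    exact: ktransform_neqNy.
  apply/eqP; rewrite eq_le ktransformK_le// andbT.
  apply: ge_ereal_sup => _ [s Ss <-]; rewrite addeC -leeBrDr ?f0_fin//.
  apply: ge_ereal_sup => _ [[|n] [xs [ys [// _ xs0 xsn Mi ->]]]].
  rewrite leeBrDr ?f0_fin//.
  have {}Mi i : (i <= n)%N -> M (xs i) (ys i) by exact: Mi.
  have [h Fh] := F0; have [_ Bn _ _] := graph_antider_family Fh (Mi _ (leqnn n)).
  (* [v] is the chain value at [xs n]. Ending the chain at an arbitrary [x'] bounds [H x'] below by
     [v + k x' (ys n) - k (xs n) (ys n)], hence the transform of [H] at [ys n] above; the term of
     the double transform at [ys n] then dominates the chain value at [x]. *)
  pose v := (fine (f0 s) + \sum_(0 <= i < n) (k (xs i.+1) (ys i) - k (xs i) (ys i)))%R.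
  have hv : ktransform A k H (ys n) <= (k (xs n) (ys n) - v)%:E.
    apply: ktransform_leP => x' Ax'; have := rockafellar_chain k x' Mi.
    rewrite xs0 => /(leeD2l (f0 s))/le_trans/(_ (le_H x' Ss)).
    rewrite -(fineK (f0_fin Ss)) /v; case: (H x') => [q| |] //; last by rewrite leNye.
    by rewrite -EFinD -EFinB !lee_fin => ?; lra.
  have := ktransform_ge (flip_kernel k) (ktransform A k H) x Bn; apply: le_trans.
  rewrite big_nat_recr//= xsn /flip_kernel -(fineK (f0_fin Ss)); move: hv; rewrite /v.
  case: (ktransform A k H (ys n)) => [q| |] //; last by rewrite leey.
  by rewrite -EFinB -EFinD !lee_fin => ?; lra.
- have [h Fh] := F0.
  move=> [x y] Mxy; have [Ax By _ _] := graph_antider_family Fh Mxy; split => //= x' Ax'.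
  (* The subgradient inequality is proved for each term of the supremum [H x], by prolonging chains
     with [(x, y)]. *)
  rewrite -leeBrDr//; apply: ge_ereal_sup => _ [s Ss <-].
  rewrite leeBrDr// -leeBlDr// -addeA -addeA.
  by rewrite (le_trans _ (le_H x' Ss))// leeD2l// rockafellar_step.
Qed.

Lemma lower_envelopeE x : A x -> lower_envelope F x = H x.
Proof.
move=> Ax; apply/eqP; rewrite eq_le; apply/andP; split.
  by apply: ereal_inf_lbound; exists H => //; exact: rockafellar_antider_family.
by apply: le_ereal_inf_tmp => _ [h Fh <-]; exact: rockafellar_lower_bound.
Qed.

Lemma lower_envelope_antider_family : F (lower_envelope F).
Proof.
apply: eq_antider_family rockafellar_antider_family => // x Ax.
by rewrite lower_envelopeE.
Qed.

Lemma lower_envelope_le h x : F h -> lower_envelope F x <= h x.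
Proof. by move=> Fh; apply: ereal_inf_lbound; exists h. Qed.

Lemma upper_envelope_ge h x : F h -> h x <= upper_envelope F x.
Proof. by move=> Fh; apply: ereal_sup_ubound; exists h. Qed.

(** Each member equals its double transform, which is monotone, so it stays below the double
    transform of the supremum. The subgradient inequalities and the values on [S] pass to
    suprema. *)
Lemma upper_envelope_antider_family : F (upper_envelope F).
Proof.
have [h0 Fh0] := F0.
have GS s : S s -> upper_envelope F s = f0 s.
  move=> Ss; apply/eqP; rewrite eq_le; apply/andP; split.
    by apply: ge_ereal_sup => _ [h [_ _ hS] <-]; rewrite hS.
  by have [_ _ <-//] := Fh0; exact: upper_envelope_ge.
have Gp : proper_fun A (upper_envelope F).
  have [[[h0N _] _] _ _] := Fh0; split=> [x Ax|].
    have := upper_envelope_ge x Fh0; have := h0N _ Ax.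
    by rewrite -!ltNye => /lt_le_trans; apply.
  have [s Ss] := S0; exists s; split; first exact: S_A.
  by rewrite GS// ltey_eq f0_fin.
split=> //.
- split=> //; exists (ktransform A k (upper_envelope F)); split=> [y By|x Ax].
    exact: ktransform_neqNy.
  apply/eqP; rewrite eq_le ktransformK_le// andbT.
  apply: ge_ereal_sup => _ [h Fh <-]; have [hc _ _] := Fh.
  rewrite -(kconvexK hc Ax); apply: ktransform_anti => y By.
  by apply: ktransform_anti => x' Ax'; exact: upper_envelope_ge.
- move=> [x y] Mxy; have [Ax By _ _] := graph_antider_family Fh0 Mxy; split=> //= x' Ax'.
  rewrite -leeBrDr//; apply: ge_ereal_sup => _ [h Fh <-]; rewrite leeBrDr//.
  have [_ hM _] := Fh; have [_ _ /(_ _ Ax')] := hM _ (Mxy : graph M (x, y)).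
  by move=> /le_trans; apply; rewrite leeD2r// upper_envelope_ge.
Qed.

Lemma ktransform_upper_envelope (g0 : U -> \bar R) y :
  (forall s y', S s -> M s y' -> g0 y' = (k s y')%:E - f0 s) -> B y ->
  ktransform A k (upper_envelope F) y =
  lower_envelope (antider_family B A (flip_kernel k) (mimage M S) g0 (minv M)) y.
Proof.
move=> g0E By.
have M0 : graph M !=set0 by have [s /S_dom[y' ?]] := S0; exists (s, y').
have toD h : F h -> antider_family B A (flip_kernel k) (mimage M S) g0 (minv M)
    (ktransform A k h).
  by apply: antider_family_ktransform => // s y' Ss Msy _; exact: g0E.
(* The way back: every point of [S] has an image in [M(S)], since [S] lies in the domain of [M], and
   the relation between [f0] and [g0] can be solved for the finite number [f0 x]. *)
have toF g : antider_family B A (flip_kernel k) (mimage M S) g0 (minv M) g ->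
    F (ktransform B (flip_kernel k) g).
  have [[s y'] Msy] := M0.
  apply: (@antider_family_ktransform _ _ _ _ _ (flip_kernel k)); first by exists (y', s).
    by move=> x Sx; have [y2 ?] := S_dom Sx; exists y2 => //; exists x.
  move=> y2 x [s2 Ss2 Ms2] Mx Sx; rewrite (g0E x)// /flip_kernel.
  by rewrite -(fineK (f0_fin Sx)) -!EFinB; congr EFin; lra.
apply/eqP; rewrite eq_le; apply/andP; split.
  apply: le_ereal_inf_tmp => _ [g Dg <-]; have [gc _ _] := Dg.
  rewrite -(kconvexK gc By); apply: ktransform_anti => x Ax.
  by apply: upper_envelope_ge; exact: toF.
by apply: ereal_inf_lbound; exists (ktransform A k (upper_envelope F)) => //;
  apply: toD; exact: upper_envelope_antider_family.
Qed.

End envelopes.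

(** * Borel measures on Polish spaces *)

(** The empty case stands apart because an empty [D] is not the range of a sequence. *)
Lemma countable_bigcup_range (I T : Type) (D : set I) (F : I -> set T) :
  countable D -> \bigcup_(i in D) F i = set0 \/
  exists e : nat -> I, (forall n, D (e n)) /\
    \bigcup_(i in D) F i = \bigcup_n F (e n).
Proof.
move=> /pfcard_geP[->|[e]]; first by left; rewrite bigcup_set0.
right; exists e; split=> [n|]; first exact: (@funS _ _ _ _ e n).
apply/seteqP; split=> [x [i Di Fx]|x [n _ Fx]].
  by have [n _ eni] := @surj _ _ _ _ e i Di; exists n => //; rewrite eni.
by exists (e n) => //; exact: (@funS _ _ _ _ e n).
Qed.

Lemma countable_bigcup_measurable d (T : measurableType d) (I : Type)
    (D : set I) (F : I -> set T) :
  countable D -> (forall i, D i -> measurable (F i)) ->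
  measurable (\bigcup_(i in D) F i).
Proof.
move=> /(countable_bigcup_range F)[->//|[e [De ->]]] mF.
by apply: bigcupT_measurable => n; exact: mF.
Qed.

Lemma countable_bigcup_negligible d (T : measurableType d) (R : realType)
    (mu : {measure set T -> \bar R}) (I : Type) (D : set I) (F : I -> set T) :
  countable D -> (forall i, D i -> mu.-negligible (F i)) ->
  mu.-negligible (\bigcup_(i in D) F i).
Proof.
move=> /(countable_bigcup_range F)[->|[e [De ->]]] F0.
  exact: negligible_set0.
by apply: negligible_bigcup => n; exact: F0.
Qed.

(** The base consists of balls with centres in [D] and radii [1 / n.+1]; interiors are taken because
    balls of a pseudometric structure need not be open. *)
Lemma dense_second_countable (R : realType) (X : pseudoMetricType R) (D : set X) :
  countable D -> dense D -> @second_countable X.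
Proof.
move=> cD dD; pose r n : R := (n.+1%:R^-1)%R.
have r0 n : (0 < r n)%R by rewrite invr_gt0.
exists [set (ball z.1 (r z.2))° | z in D `*` [set: nat]].
  by apply: (sub_countable (card_image_le _ _)); apply: countableX.
split=> [_ [z _ <-]|x V /nbhs_ballP[e /= e0 eV]]; first exact: open_interior.
have e20 : (0 < e / 2)%R by rewrite divr_gt0.
have [n] := ltr_add_invr e20; rewrite add0r -/(r n) => ne.
(* Chosen so that [m.+1 = 2 * n.+1], that is [r m = r n / 2]. A centre [d] within [r m] of [x] has a
   ball of radius [r n] that is a neighbourhood of [x] and remains inside [ball x e]. *)
pose m := (2 * n.+1).-1.
have rm : (r m = r n / 2)%R.
  by rewrite /r /m prednK ?muln_gt0// natrM invfM mulrC.
have [|d [/interior_subset xd Dd]] := dD _ _ (open_interior (ball x (r m))).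
  by exists x; exact: nbhsx_ballx.
exists (ball d (r n))°.
  split; first by exists (d, n).
  apply/nbhs_ballP; exists (r m) => //= y xy.
  by apply: (@ball_splitr _ _ x); rewrite -rm //; exact: ball_sym.
move=> y /interior_subset dy; apply: eV.
rewrite (splitr e); apply: (@ball_triangle _ _ d); last exact: le_ball (ltW ne) _ dy.
apply: le_ball xd; rewrite rm; have := r0 n; move: ne; lra.
Qed.

Lemma polish_second_countable (R : realType) (X : completePseudoMetricType R) :
  polish X -> @second_countable X.
Proof. by move=> [_ [D cD dD]]; exact: dense_second_countable cD dD. Qed.

Lemma open_measurable_borel (X : ptopologicalType) (O : set (borel X)) :
  @open X O -> measurable O.
Proof. exact: sub_sigma_algebra. Qed.

Lemma closed_measurable_borel (X : ptopologicalType) (C : set (borel X)) :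
  @closed X C -> measurable C.
Proof.
by move=> cC; rewrite -(setCK C); apply: measurableC; apply: open_measurable_borel; rewrite openC.
Qed.

(** An open set is the union of the basic rectangles that it contains, and there are countably many
    of them. *)
Lemma open_measurable_prod (X Y : ptopologicalType) (O : set (borel X * borel Y)) :
  @second_countable X -> @second_countable Y -> @open (X * Y)%type O -> measurable O.
Proof.
move=> [BX cX [oX bX]] [BY cY [oY bY]] oO.
have -> : O = \bigcup_(p in [set p | [/\ BX p.1, BY p.2 & p.1 `*` p.2 `<=` O]])
    (p.1 `*` p.2); last first.
  apply: countable_bigcup_measurable => [|p [/oX o1 /oY o2 _]].
    apply: (@sub_countable _ _ _ (BX `*` BY)); last exact: countableX.
    by apply: subset_card_le => p [].
  by apply: measurableX; exact: open_measurable_borel.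
apply/seteqP; split=> [z Oz|z [p [_ _ pO] pz]]; last exact: pO.
have [[P Q] [/= nP nQ] PQO] : nbhs (z : X * Y) O by exact: open_nbhs_nbhs.
have [U [BU Uz] UP] := bX _ _ nP; have [V [BV Vz] VQ] := bY _ _ nQ.
exists (U, V) => //=; split=> // t [/= /UP ? /VQ ?]; exact: PQO.
Qed.

(** Each point outside the support has a null basic neighbourhood, and countably many of these cover
    the complement of [A]. *)
Lemma msupport_negligible (R : realType) (X : ptopologicalType)
    (mu : {measure set (borel X) -> \bar R}) (A : set X) :
  @second_countable X -> closed A -> msupport mu `<=` A -> mu (~` A) = 0.
Proof.
move=> [B cB [oB bB]] cA suppA; apply/negligibleP.
  by apply: measurableC; exact: closed_measurable_borel.
have cover0 : mu.-negligible (\bigcup_(U in [set U : set (borel X) | B U /\ mu U = 0]) U).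
  apply: countable_bigcup_negligible => [|U [BU U0]].
    by apply: (@sub_countable _ _ _ B) => //; apply: subset_card_le => U [].
  by apply/negligibleP => //; apply: open_measurable_borel; exact: oB.
apply: (negligibleS _ cover0) => x Ax.
have : ~ msupport mu x by move/suppA.
move=> /existsNP[V /not_implyP[oV /not_implyP[Vx /negP]]].
rewrite -leNgt => V0.
have [U [BU Ux] UV] := bB _ _ (open_nbhs_nbhs (conj oV Vx)).
exists U => //; split=> //; apply/eqP; rewrite -measure_le0 (le_trans _ V0)//.
by apply: le_measure => //; rewrite inE; apply: open_measurable_borel => //; exact: oB.
Qed.

Section finite_measure.
Context d (T : measurableType d) (R : realType) (m : {measure set T -> \bar R}).

Lemma measure_bigcup_small (F : (set T)^nat) (e : R) : (0 <= e)%R ->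
  (forall n, measurable (F n)) -> (forall n, m (F n) <= (e / (2 ^ n.+1)%:R)%:E) ->
  m (\bigcup_n F n) <= e%:E.
Proof.
move=> e0 mF Fe; apply: le_trans (epsilon_trick0 xpredT e0).
apply: (@le_trans _ _ (\sum_(i <oo) m (F i))).
  by apply: generalized_Boole_inequality => //; exact: bigcupT_measurable.
exact: lee_nneseries.
Qed.

Hypothesis mfin : m setT < +oo.

(** Continuity from above; it serves to replace a countable union by a finite one at small cost in
    measure. *)
Lemma measure_bigcap_small (F : (set T)^nat) (A : set T) (e : R) :
  (forall n, measurable (F n)) -> nonincreasing_seq F -> \bigcap_n F n `<=` A ->
  measurable A -> m A < e%:E -> exists n, m (F n) < e%:E.
Proof.
move=> mF niF FA mA Ae.
have F0 : m (F 0%N) < +oo.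
  by apply: le_lt_trans mfin; apply: le_measure; rewrite ?inE.
have mcap : measurable (\bigcap_n F n) by exact: bigcapT_measurable.
have := nonincreasing_cvg_mu F0 mF mcap niF.
have : m (\bigcap_n F n) < e%:E.
  by apply: le_lt_trans Ae; apply: le_measure; rewrite ?inE.
move=> /open_ereal_lt' ltce /(_ _ ltce)[N _ /(_ N (leqnn N))].
by exists N.
Qed.

End finite_measure.

(** * Regularity of finite Borel measures on pseudometric spaces *)

Section regularity.
Context (R : realType) (Z : pseudoPMetricType R) (m : {measure set (borel Z) -> \bar R}).
Hypothesis mfin : m setT < +oo.

(** The two-sided approximation makes the class stable under complements; it is shown to be a
    sigma-algebra containing the open sets. *)
Let regular (E : set (borel Z)) := measurable E /\ forall e : R, (0 < e)%R ->
  exists C O : set Z, [/\ closed C, open O, C `<=` E, E `<=` O & m (O `\` C) < e%:E].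

Let mOC (C O : set Z) : closed C -> open O -> measurable (O `\` C : set (borel Z)).
Proof.
move=> cC oO; apply: (@measurableD _ (borel Z)).
  exact: open_measurable_borel.
exact: closed_measurable_borel.
Qed.

Let regular_open (U : set Z) : open U -> regular U.
Proof.
move=> oU; split=> [|e e0]; first exact: open_measurable_borel.
pose r n : R := (n.+1%:R^-1)%R.
have r0 n : (0 < r n)%R by rewrite invr_gt0.
(* Open neighbourhoods of the complement of [U] that shrink to it, so their complements are closed
   sets exhausting [U]. *)
pose O n : set Z := \bigcup_(x in ~` U) (ball x (r n))°.
have oO n : open (O n) by apply: bigcup_open => x _; exact: open_interior.
have UO n : ~` U `<=` O n by move=> x Ux; exists x => //; exact: nbhsx_ballx.
have [n On] : exists n, m (O n `\` ~` U) < e%:E.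
  apply: (@measure_bigcap_small _ _ _ _ mfin _ set0) => //.
  - by move=> n; apply: mOC => //; rewrite closedC.
  - apply/nonincreasing_seqP => n; apply/subsetPset => x [[y Uy yx] Ux]; split=> //.
    exists y => //; apply: filterS yx; apply: le_ball.
    by rewrite lef_pV2 ?posrE// ler_nat.
  - move=> x cap; have Ux : U x by have [_ /contrapT] := cap 0%N I.
    have /nbhs_ballP[d /= d0 dU] := open_nbhs_nbhs (conj oU Ux).
    have [n] := ltr_add_invr (d0 : (0 < d)%R); rewrite add0r -/(r n) => nd.
    have [[y Uy /interior_subset yx] _] := cap n I.
    by apply: Uy; apply: dU; apply: le_ball (ltW nd) _ _; exact: ball_sym.
  - by rewrite measure0 lte_fin.
exists (~` O n), U; split=> //.
- by rewrite closedC.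
- by move=> x /(contra_not (@UO n x)) /contrapT.
by rewrite setDE setCK setIC -[X in _ `&` X]setCK -setDE.
Qed.

Let regularC (E : set (borel Z)) : regular E -> regular (~` E).
Proof.
move=> [mE rE]; split=> [|e /rE[C [V [cC oV CE EV VC]]]]; first exact: measurableC.
exists (~` V), (~` C); rewrite closedC openC; split=> //; do ?exact: subsetC.
by rewrite setDE setCK setIC -setDE.
Qed.

Let regular_bigcup (E : (set (borel Z))^nat) : (forall n, regular (E n)) ->
  regular (\bigcup_n E n).
Proof.
move=> rE; split=> [|e e0]; first by apply: bigcupT_measurable => n; have [] := rE n.
have e20 : (0 < e / 2)%R by rewrite divr_gt0.
(* The gaps sum to at most [e / 2]. A countable union of closed sets need not be closed, so it is
   cut at a finite stage [N], within the remaining margin. *)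
have /choice[CO hCO] n : exists CO : set Z * set Z,
    [/\ closed CO.1, open CO.2, CO.1 `<=` E n, E n `<=` CO.2 &
      m (CO.2 `\` CO.1) < (e / 2 / (2 ^ n.+1)%:R)%:E].
  have [|C [V ?]] := (rE n).2 (e / 2 / (2 ^ n.+1)%:R)%R; last by exists (C, V).
  by rewrite divr_gt0.
pose O : set Z := \bigcup_n (CO n).2.
pose C N : set Z := \big[setU/set0]_(i < N) (CO i).1.
have oO : open O by apply: bigcup_open => n _; have [] := hCO n.
have cC N : closed (C N) by apply: closed_bigsetU => n _; have [] := hCO n.
have mD n : measurable ((CO n).2 `\` (CO n).1 : set (borel Z)).
  by have [? ? _ _ _] := hCO n; exact: mOC.
have [N ON] : exists N, m (O `\` C N) < e%:E.
  apply: (@measure_bigcap_small _ _ _ _ mfin _ (\bigcup_n ((CO n).2 `\` (CO n).1))) => //.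
  - by move=> N; exact: mOC.
  - apply/nonincreasing_seqP => n; apply/subsetPset; apply: setDS.
    by rewrite /C big_ord_recr/=; exact: subsetUl.
  - move=> x cap; have [[n _ Ox] _] := cap 0%N I; exists n => //; split=> // Cx.
    have [_] := cap n.+1 I; apply; rewrite /C big_ord_recr/=; right; exact: Cx.
  - exact: bigcupT_measurable.
  - apply: (@le_lt_trans _ _ (e / 2)%:E); last by rewrite lte_fin; lra.
    apply: measure_bigcup_small => //; first exact: ltW.
    by move=> n; have [_ _ _ _ /ltW] := hCO n.
exists (C N), O; split => //.
- apply: (big_ind (fun A => A `<=` \bigcup_n E n)) => [|A1 A2|i _ x Cx] //.
    by rewrite subUset.
  by exists (val i) => //; have [_ _ + _ _] := hCO i; apply.
- by apply: subset_bigcup => n _; have [] := hCO n.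
Qed.

Lemma borel_closed_regular (E : set (borel Z)) (e : R) : measurable E -> (0 < e)%R ->
  exists C : set Z, [/\ closed C, C `<=` E & m (E `\` C) < e%:E].
Proof.
move=> mE e0.
have [_ /(_ _ e0)[C [V [cC oV CE EV VC]]]] : regular E.
  apply: (smallest_sub _ _ mE); last exact: regular_open.
  split; [exact: (regular_open open0)|by move=> A /regularC; rewrite setTD|exact: regular_bigcup].
exists C; split=> //; apply: le_lt_trans VC; apply: le_measure; rewrite ?inE.
- apply: (@measurableD _ (borel Z)) => //; exact: closed_measurable_borel.
- exact: mOC.
- exact: setSD.
Qed.

End regularity.

Lemma ultra_bigsetU (T : Type) (F : set_system T) (A : nat -> set T) N :
  UltraFilter F -> F (\big[setU/set0]_(i < N) A i) -> exists i, F (A i).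
Proof.
move=> FU; elim: N => [|N IH]; first by rewrite big_ord0 => /filter_not_empty.
rewrite big_ord_recr/= => FAN.
have [?|FnA] := in_ultra_setVsetC (A N) FU; first by exists N.
by apply: IH; apply: filterS (filterI FAN FnA) => x [[|]].
Qed.

(** Ulam's theorem. For each radius, finitely many closed balls carry all but a small part of the
    mass; the intersection over all radii is closed and totally bounded, hence compact by
    completeness. *)
Lemma polish_tight (R : realType) (Z : completePseudoMetricType R)
    (m : {measure set (borel Z) -> \bar R}) (e : R) :
  polish Z -> m setT < +oo -> (0 < e)%R ->
  exists K : set Z, [/\ compact K, closed K & m (~` K) < e%:E].
Proof.
move=> [_ [D cD dD]] mfin e0.
have e20 : (0 < e / 2)%R by rewrite divr_gt0.
pose r n : R := (n.+1%:R^-1)%R.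
have r0 n : (0 < r n)%R by rewrite invr_gt0.
have [s sD] : exists s : nat -> Z, forall x n, exists i, ball (s i) (r n) x.
  move/pfcard_geP : cD => [D0|[s]].
    by have := dD _ (ex_intro _ point Logic.I) openT; rewrite D0 setI0 => -[].
  exists s => x n.
  have [|d [/interior_subset xd Dd]] := dD _ _ (open_interior (ball x (r n))).
    by exists x; exact: nbhsx_ballx.
  by have [i _ sid] := @surj _ _ _ _ s d Dd; exists i; rewrite sid; exact: ball_sym.
pose B n N : set Z := \big[setU/set0]_(i < N) closure (ball (s i) (r n)).
have cB n N : closed (B n N) by apply: closed_bigsetU => i _; exact: closed_closure.
have mB n N : measurable (~` B n N : set (borel Z)).
  by apply: open_measurable_borel; rewrite openC.
have /choice[N hN] n : exists N, m (~` B n N) < (e / 2 / (2 ^ n.+1)%:R)%:E.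
  apply: (@measure_bigcap_small _ _ _ _ mfin _ set0) => //.
  - apply/nonincreasing_seqP => N; apply/subsetPset; apply: subsetC.
    by rewrite /B big_ord_recr/=; exact: subsetUl.
  - move=> x cap; have [i xi] := sD x n.
    apply: (cap i.+1 I); rewrite /B big_ord_recr/=; right; exact: subset_closure.
  - by rewrite measure0 lte_fin divr_gt0.
pose K : set Z := \bigcap_n B n (N n).
have cK : closed K by apply: closed_bigI => n _.
exists K; split=> //; last first.
  rewrite /K setC_bigcap; apply: (@le_lt_trans _ _ (e / 2)%:E); last by rewrite lte_fin; lra.
  apply: measure_bigcup_small => //; first exact: ltW.
  by move=> n; exact: ltW.
rewrite compact_ultra => F FU FK.
(* An ultrafilter containing a finite union contains one of its pieces; taking smaller and smaller
   radii shows that it is Cauchy. *)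
have /cauchy_cvg Fcvg : cauchy F.
  apply: cauchy_exP => d d0.
  have d20 : (0 < d / 2)%R by rewrite divr_gt0.
  have [n] := ltr_add_invr d20; rewrite add0r -/(r n) => nd.
  have FB : F (B n (N n)) by apply: filterS FK => x; apply.
  have [i Fi] := @ultra_bigsetU _ F (fun i => closure (ball (s i) (r n))) _ FU FB.
  exists (s i); apply: filterS Fi => x xi.
  have [y [siy xy]] := xi _ (nbhsx_ballx x _ d20).
  rewrite (splitr d); apply: (@ball_triangle _ _ y); last exact: ball_sym.
  exact: le_ball (ltW nd) _ siy.
exists (lim F); split=> //; apply: cK => U /Fcvg FU'.
exact: filter_ex (filterI FK FU').
Qed.

HB.instance Definition _ (R : realType) (X Y : pseudoPMetricType R) :=
  Pointed.on (X * Y)%type.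

(** * Projections of sets that carry a plan *)

Section projection.
Context (R : realType) (X Y : completePseudoMetricType R).
Hypotheses (polX : polish X) (polY : polish Y).
Variables (rho : probability (borel X * borel Y)%type R).
Variables (mu : probability (borel X) R) (nu : probability (borel Y) R).
Hypothesis rhoX : forall E, measurable E -> rho (E `*` [set: borel Y]) = mu E.
Hypothesis rhoY : forall E, measurable E -> rho ([set: borel X] `*` E) = nu E.

(** The identity, read from the product sigma-algebra to the Borel sigma-algebra of the product
    topology. Pushing [rho] forward along it gives a Borel measure, to which regularity applies. *)
Let idXY (z : borel X * borel Y) : borel (X * Y)%type := z.

Lemma measurable_prod_borel (E : set (borel X * borel Y)) :
  measurable E -> measurable (E : set (borel (X * Y)%type)).
Proof.
apply: smallest_sub; first exact: (@smallest_sigma_algebra _ setT (@open (X * Y)%type)).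
move=> _ [] [A mA <-].
  have : measurable_fun setT (fst : borel (X * Y)%type -> borel X).
    apply: measurability => // _ [U oU <-]; apply: measurableI => //.
    by apply: open_measurable_borel; apply: open_comp => // z _; exact: cvg_fst.
  exact.
have : measurable_fun setT (snd : borel (X * Y)%type -> borel Y).
  apply: measurability => // _ [U oU <-]; apply: measurableI => //.
  by apply: open_measurable_borel; apply: open_comp => // z _; exact: cvg_snd.
exact.
Qed.

Let mid : measurable_fun setT idXY.
Proof.
apply: measurability => // _ [U oU <-]; rewrite setTI.
by apply: open_measurable_prod oU; exact: polish_second_countable.
Qed.

(** A closed set approximating [E] is cut by a product of compact sets that nearly carry the
    marginals; each of the three losses is below [e / 3]. *)
Lemma compact_regular_prod (E : set (borel X * borel Y)) (e : R) :
  measurable E -> (0 < e)%R ->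
  exists K : set (X * Y), [/\ compact K, measurable (K : set (borel X * borel Y)), K `<=` E &
    rho (E `\` K) < e%:E].
Proof.
move=> mE e0; have e30 : (0 < e / 3)%R by rewrite divr_gt0.
have rhofin : pushforward rho idXY setT < +oo.
  by rewrite /pushforward preimage_setT probability_setT ltry.
have [C [cC CE EC]] := borel_closed_regular rhofin (measurable_prod_borel mE) e30.
have mufin : mu setT < +oo by rewrite probability_setT ltry.
have nufin : nu setT < +oo by rewrite probability_setT ltry.
have [K [K_compact cK Ke]] := polish_tight polX mufin e30.
have [L [L_compact cL Le]] := polish_tight polY nufin e30.
have mC : measurable (C : set (borel X * borel Y)).
  rewrite -(setCK C); apply: measurableC; apply: open_measurable_prod; rewrite ?openC//;
    exact: polish_second_countable.
have mK : measurable (K : set (borel X)) by exact: closed_measurable_borel.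
have mL : measurable (L : set (borel Y)) by exact: closed_measurable_borel.
exists (C `&` K `*` L); split.
- by rewrite setIC; apply: compact_closedI => //; exact: compact_setX.
- by apply: measurableI => //; exact: measurableX.
- by move=> z [/CE].
have sub : E `\` (C `&` K `*` L) `<=`
    (E `\` C) `|` ((~` K `*` [set: borel Y]) `|` ([set: borel X] `*` ~` L)).
  move=> [x y] [Exy nCKL].
  have [Cxy|] := pselect (C (x, y)); last by left.
  right; have [Kx|] := pselect (K x); last by left.
  by right; split=> // Ly; apply: nCKL.
have mKC : measurable (~` K `*` [set: borel Y] : set (borel X * borel Y)).
  by apply: measurableX => //; exact: measurableC.
have mLC : measurable ([set: borel X] `*` ~` L : set (borel X * borel Y)).
  by apply: measurableX => //; exact: measurableC.
have mEC : measurable (E `\` C) by exact: measurableD.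
apply: (@le_lt_trans _ _
  (rho ((E `\` C) `|` ((~` K `*` [set: borel Y]) `|` ([set: borel X] `*` ~` L))))).
  apply: le_measure sub; rewrite inE; last by do 2 apply: measurableU => //.
  apply: measurableD => //; apply: measurableI => //; exact: measurableX.
apply: (@le_lt_trans _ _
  (rho (E `\` C) + (rho (~` K `*` [set: borel Y]) + rho ([set: borel X] `*` ~` L)))).
  apply: le_trans (measureU2 _ _ _) _ => //; first exact: measurableU.
  by apply: leeD2l; exact: measureU2.
have -> : e%:E = (e / 3)%:E + ((e / 3)%:E + (e / 3)%:E).
  by rewrite -!EFinD; congr EFin; lra.
rewrite rhoX ?rhoY; [|exact: measurableC|exact: measurableC].
by apply: lteD => //; apply: lteD.
Qed.

(** Projections of compact sets are closed, hence measurable, and those of the compact sets [K n]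
    inside the carrier of [rho] leave out only a null set. *)
Lemma concentrated_fst (G : set (X * Y)) : concentrated rho G ->
  concentrated mu (fst @` G).
Proof.
move=> [N [mN N0 GN]].
pose r n : R := (n.+1%:R^-1)%R.
have r0 n : (0 < r n)%R by rewrite invr_gt0.
have /choice[K hK] n := compact_regular_prod (measurableC mN) (r0 n).
have cK n : closed (fst @` K n).
  apply: compact_closed; first by have [] := polX.
  apply: continuous_compact; last by have [] := hK n.
  by apply: continuous_subspaceT => z; exact: cvg_fst.
have mK : measurable (\bigcup_n fst @` K n : set (borel X)).
  by apply: bigcupT_measurable => n; exact: closed_measurable_borel.
exists (~` \bigcup_n fst @` K n); split; first exact: measurableC.
  apply/eqP; rewrite -measure_le0; apply/lee_addgt0Pr => e e0; rewrite add0e.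
  have [n] := ltr_add_invr e0; rewrite add0r -/(r n) => ne.
  have [_ mKn KnN /ltW Kne] := hK n.
  apply: (@le_trans _ _ (r n)%:E); last by rewrite lee_fin ltW.
  rewrite -[leLHS](rhoX (measurableC mK)).
  have mNK : measurable (~` N `\` K n) by apply: measurableD => //; exact: measurableC.
  (* A point whose first coordinate avoids every projection lies in the null set [N] or, outside
     [N], off [K n]. *)
  apply: (@le_trans _ _ (rho (N `|` (~` N `\` K n)))).
    apply: le_measure; rewrite ?inE; first by apply: measurableX => //; exact: measurableC.
      exact: measurableU.
    move=> z [nz _]; have [Nz|nNz] := pselect (N z); [by left|right; split=> // Kz].
    by apply: nz; exists n => //; exists z.
  by rewrite (le_trans (measureU2 _ _ _))// [X in X + _]N0 add0e.
apply: subsetC => x [n _ [z Kz <-]]; exists z => //.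
have [_ _ KN _] := hK n; apply: contrapT => nG; exact: (KN _ Kz (GN _ nG)).
Qed.

End projection.

(** * Plans and their integrals *)

Section measures.
Context d (T : measurableType d) (R : realType).
Implicit Types (m : {measure set T -> \bar R}) (D N : set T) (f g : T -> \bar R).

Lemma measure_complement m1 m2 : m1 setT < +oo ->
  (forall E, measurable E -> m2 E <= m1 E) ->
  exists m, forall E, measurable E -> m1 E = m2 E + m E.
Proof.
move=> m1fin m21.
have fin1 E : measurable E -> m1 E \is a fin_num.
  move=> mE; rewrite ge0_fin_numE//; apply: le_lt_trans m1fin.
  by apply: le_measure; rewrite ?inE.
have fin2 E : measurable E -> m2 E \is a fin_num.
  by move=> mE; rewrite ge0_fin_numE// (le_lt_trans (m21 _ mE))// -ge0_fin_numE// fin1.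
(* A measure takes nonnegative values on all sets, whereas [m2 <= m1] is known on measurable sets
   only; elsewhere the value is 0. *)
pose s (E : set T) : \bar R := if `[< measurable E >] then m1 E - m2 E else 0.
have sE E : measurable E -> s E = m1 E - m2 E by move=> mE; rewrite /s asboolT.
have s0 : s set0 = 0 by rewrite sE// !measure0 subee.
have s_ge0 E : 0 <= s E.
  by rewrite /s; case: ifPn => // /asboolP mE; rewrite sube_ge0 ?m21// fin2.
have s_sigma : semi_sigma_additive s.
  move=> F mF tF mUF; rewrite sE//.
  have -> : (fun n => \sum_(0 <= i < n) s (F i)) =
      (fun n => \sum_(0 <= i < n) m1 (F i) - \sum_(0 <= i < n) m2 (F i)).
    apply/funext => n; rewrite -sumeN; last first.
      by move=> p q _ _; rewrite fin_num_adde_defl// fin2.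
    by rewrite -big_split/=; apply: eq_bigr => i _; rewrite sE.
  apply: cvgeB; first by rewrite fin_num_adde_defr// fin1.
    exact: measure_semi_sigma_additive.
  exact: measure_semi_sigma_additive.
pose P := isMeasure.Build _ _ _ s s0 s_ge0 s_sigma.
pose sm : {measure set T -> \bar R} := HB.pack s P.
by exists sm => E mE; rewrite /sm/= sE// addeC subeK ?fin2.
Qed.

Lemma measure_probability m : m setT = 1 ->
  exists P : probability T R, forall E, P E = m E.
Proof.
move=> m1; exists (mnormalize m point) => E.
by rewrite /= /mnormalize m1 onee_eq0/= invr1 mule1.
Qed.

(** Write [m1] as [m2] plus a measure; the integral of the absolute value is additive in the
    measure. *)
Lemma integrable_measure_le m1 m2 D f : m1 setT < +oo ->
  (forall E, measurable E -> m2 E <= m1 E) -> measurable D ->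
  m1.-integrable D f -> m2.-integrable D f.
Proof.
move=> m1fin m21 mD /integrableP[mf f1]; apply/integrableP; split=> //.
have [m m12] := measure_complement m1fin m21.
apply: le_lt_trans f1.
rewrite [leRHS](@eq_measure_integral _ _ _ _ (measure_add m2 m)); last first.
  by move=> E mE _; rewrite m12 //; exact/esym/measure_addE.
have mabs : measurable_fun D (abse \o f) by exact: measurableT_comp.
rewrite ge0_integral_measure_add//.
by rewrite leeDl// integral_ge0.
Qed.

Lemma integrable_scale m1 m2 (r : R) D f : (0 <= r)%R -> measurable D ->
  (forall E, measurable E -> m2 E = r%:E * m1 E) ->
  m1.-integrable D f -> m2.-integrable D f /\
  \int[m2]_(x in D) f x = r%:E * \int[m1]_(x in D) f x.
Proof.
move=> r0 mD m21 f1; have mf := measurable_int _ f1.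
have E2 (g : T -> \bar R) : measurable_fun D g -> (forall x, D x -> 0 <= g x) ->
    \int[m2]_(x in D) g x = r%:E * \int[m1]_(x in D) g x.
  move=> mg g0; rewrite -(ge0_integral_mscale m1 mD (NngNum r0))//.
  by apply: eq_measure_integral => E mE _; exact: m21.
split.
  apply/integrableP; split=> //; rewrite E2//; last exact: measurableT_comp.
  have /integrableP[_] := f1.
  have := @integral_ge0 _ _ _ m1 D (abse \o f) (fun _ _ => abse_ge0 _).
  by rewrite /comp; case: (\int[m1]_(x in D) `|f x|) => // s _ _; rewrite -EFinM ltry.
rewrite integralE [in RHS]integralE.
rewrite !E2//; [|exact: measurable_funeneg|exact: measurable_funepos].
by rewrite [RHS]muleBr//; exact: integrable_add_def.
Qed.

(** The minorant controls the negative part; the positive part is then finite because the whole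
    integral is below [+oo]. *)
Lemma integrable_lower_bound m D f g : measurable D -> measurable_fun D f ->
  m.-integrable D g -> (forall x, D x -> g x <= f x) ->
  \int[m]_(x in D) f x < +oo -> m.-integrable D f.
Proof.
move=> mD mf ig gf f_lty.
have ifn : m.-integrable D f^\-.
  apply: le_integrable (integrable_funeneg mD ig) => //; first exact: measurable_funeneg.
  move=> x Dx; rewrite !gee0_abs// !funenegE ge_max !le_max leeN2 gf//=.
  by rewrite lexx orbT.
have ifp : m.-integrable D f^\+.
  apply/integrableP; split; first exact: measurable_funepos.
  under eq_integral do rewrite gee0_abs//.
  move: f_lty; rewrite integralE.
  have : \int[m]_(x in D) f^\- x \is a fin_num by exact: integrable_fin_num.
  case: (\int[m]_(x in D) f^\- x) => // r _.
  by case: (\int[m]_(x in D) f^\+ x) => // s _; rewrite ltry.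
by rewrite [f]funeposneg; exact: integrableB.
Qed.

(** Splitting into positive and negative parts also covers plans of infinite cost. *)
Lemma integral_full m D f : measurable D -> m (~` D) = 0 ->
  measurable_fun setT f -> \int[m]_(x in D) f x = \int[m]_x f x.
Proof.
move=> mD D0 mf; have mCD := measurableC mD.
rewrite integralE [in RHS]integralE.
rewrite [in RHS](ge0_negligible_integral mCD measurableT _ _ D0)//; last exact: measurable_funepos.
rewrite [X in _ = _ - X](ge0_negligible_integral mCD measurableT _ _ D0)//;
  last exact: measurable_funeneg.
by rewrite setTD setCK.
Qed.

Lemma has_integral_le m D f g u v : measurable D ->
  m.-negligible [set x | D x /\ ~ f x <= g x] ->
  has_integral m D f u -> has_integral m D g v -> u <= v.
Proof.
move=> mD fg [f0 [if0 ff0 <-]] [g0 [ig0 gg0 <-]].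
have [N [mN N0 sub]] := negligibleU fg (negligibleU ff0 gg0).
rewrite (negligible_integral mN mD if0 N0) (negligible_integral mN mD ig0 N0).
have mDN : measurable (D `\` N) by exact: measurableD.
have DN : D `\` N `<=` D by exact: subDsetl.
apply: le_integral => //; [exact: integrableS DN if0|exact: integrableS DN ig0|].
move=> x /[!inE] -[Dx Nx].
have [fgx|] := pselect (f x <= g x); last by move=> ?; exfalso; apply/Nx/sub; left.
have <- : f x = f0 x by apply: contrapT => ?; apply/Nx/sub; right; left.
by have <- : g x = g0 x by apply: contrapT => ?; apply/Nx/sub; right; right.
Qed.

Lemma has_integralN m D f u : measurable D -> has_integral m D f u ->
  has_integral m D (fun x => - f x) (- u).
Proof.
move=> mD [f0 [if0 ff0 <-]]; exists (fun x => - f0 x); split.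
- exact: integrableN.
- by apply: negligibleS ff0 => x [Dx nf]; split=> // ff; apply: nf; rewrite ff.
- by rewrite integralN//; exact: integrable_add_def.
Qed.

End measures.

(** * Change of variables along a measurable map *)

Section image_measure.
Context d d' (T : measurableType d) (T' : measurableType d') (R : realType).
Variables (phi : T -> T') (mphi : measurable_fun setT phi).
Variables (m : {measure set T -> \bar R}) (m' : {measure set T' -> \bar R}).
Hypothesis mE : forall E, measurable E -> m' E = m (phi @^-1` E).
Variables (D : set T') (mD : measurable D).
Implicit Types f : T' -> \bar R.

Let ge0_integral_image f : measurable_fun D f -> (forall x, 0 <= f x) ->
  \int[m']_(x in D) f x = \int[m]_(x in phi @^-1` D) f (phi x).
Proof.
move=> mf f0; rewrite -(ge0_integral_pushforward mphi)//.
by apply: eq_measure_integral => E ? _; exact: mE.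
Qed.

Lemma integral_image f : measurable_fun D f ->
  \int[m']_(x in D) f x = \int[m]_(x in phi @^-1` D) f (phi x).
Proof.
move=> mf; rewrite integralE [in RHS]integralE.
rewrite (ge0_integral_image (measurable_funepos mf))//.
rewrite (ge0_integral_image (measurable_funeneg mf))//.
by congr (_ - _); apply: eq_integral => x _; rewrite ?funeposE ?funenegE.
Qed.

Lemma integrable_image f : measurable_fun D f ->
  m'.-integrable D f <-> m.-integrable (phi @^-1` D) (f \o phi).
Proof.
move=> mf.
have mfphi : measurable_fun (phi @^-1` D) (f \o phi).
  by apply: (measurable_comp mD _ mf); [move=> _ [x Dx <-]|exact: measurable_funTS].
have mabs : measurable_fun D (fun x => `|f x|) by exact: measurableT_comp.
have H := ge0_integral_image mabs (fun=> abse_ge0 _).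
by split=> /integrableP[_ fi]; apply/integrableP; split=> //; move: fi; rewrite H.
Qed.

Lemma negligible_image (A : set T') : m'.-negligible A -> m.-negligible (phi @^-1` A).
Proof.
move=> [N [mN N0 AN]]; exists (phi @^-1` N); split.
- by rewrite -[X in measurable X]setTI; exact: mphi.
- by rewrite -mE.
- by move=> x /AN.
Qed.

End image_measure.

(** * Integration of functions of one coordinate against a plan *)

Section plans.
Context d1 d2 (T : measurableType d1) (U : measurableType d2) (R : realType).
Variables (mu : probability T R) (nu : probability U R).
Variable rho : probability (T * U)%type R.
Hypothesis rhoP : plans mu nu rho.
Variables (A : set T) (B : set U) (mA : measurable A) (mB : measurable B).

Let rho_fst E : measurable E -> mu E = rho (fst @^-1` E).
Proof. by move=> mE; rewrite -setXT; have [-> //] := rhoP. Qed.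

Let rho_snd E : measurable E -> nu E = rho (snd @^-1` E).
Proof. by move=> mE; rewrite -setTX; have [_ ->] := rhoP. Qed.

Lemma plan_integrable_fst h : measurable_fun A h ->
  mu.-integrable A h <-> rho.-integrable (A `*` setT) (h \o fst).
Proof. by rewrite setXT; exact: integrable_image. Qed.

Lemma plan_integrable_snd h : measurable_fun B h ->
  nu.-integrable B h <-> rho.-integrable (setT `*` B) (h \o snd).
Proof. by rewrite setTX; exact: integrable_image. Qed.

Hypotheses (A0 : mu (~` A) = 0) (B0 : nu (~` B) = 0).

Lemma plan_fstC0 : rho (setT `*` B `\` A `*` B) = 0.
Proof.
apply/eqP; rewrite -measure_le0 -A0 rho_fst ?le_measure ?inE//; last exact: measurableC.
- by apply: measurableD; exact: measurableX.
- by rewrite -setXT; apply: measurableX => //; exact: measurableC.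
- by move=> z [[_ Bz] nAB] Az; apply: nAB.
Qed.

Lemma plan_sndC0 : rho (A `*` setT `\` A `*` B) = 0.
Proof.
apply/eqP; rewrite -measure_le0 -B0 rho_snd ?le_measure ?inE//; last exact: measurableC.
- by apply: measurableD; exact: measurableX.
- by rewrite -setTX; apply: measurableX => //; exact: measurableC.
- by move=> z [[Az _] nAB] Bz; apply: nAB.
Qed.

Lemma plan_full : rho (~` (A `*` B)) = 0.
Proof.
apply/negligibleP; first by apply: measurableC; exact: measurableX.
have nA : rho.-negligible (fst @^-1` (~` A)).
  by apply: (negligible_image measurable_fst rho_fst); apply/negligibleP => //; exact: measurableC.
have nB : rho.-negligible (snd @^-1` (~` B)).
  by apply: (negligible_image measurable_snd rho_snd); apply/negligibleP => //; exact: measurableC.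
apply: negligibleS (negligibleU nA nB) => z nAB.
have [Az|] := pselect (A z.1); last by left.
by right => Bz; apply: nAB.
Qed.

Lemma plan_has_integral h g u v : has_integral mu A h u -> has_integral nu B g v ->
  has_integral rho (A `*` B) (fun z => g z.2 - h z.1) (v - u).
Proof.
move=> [h0 [ih hh0 <-]] [g0 [ig gg0 <-]].
have mh := measurable_int _ ih; have mg := measurable_int _ ig.
have mAB : measurable (A `*` B) by exact: measurableX.
have mAT : measurable (A `*` [set: U]) by exact: measurableX.
have mTB : measurable ([set: T] `*` B) by exact: measurableX.
have ih' := (plan_integrable_fst mh).1 ih.
have ig' := (plan_integrable_snd mg).1 ig.
have ABT : A `*` B `<=` A `*` [set: U] by move=> z [].
have TAB : A `*` B `<=` [set: T] `*` B by move=> z [].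
have ihD := integrableS mAT mAB ABT ih'.
have igD := integrableS mTB mAB TAB ig'.
exists (fun z => g0 z.2 - h0 z.1); split.
- exact: (integrableB mAB igD ihD).
- apply: negligibleS (negligibleU (negligible_image measurable_fst rho_fst hh0)
    (negligible_image measurable_snd rho_snd gg0)) => z [[Az Bz] ne].
  have [hz|] := pselect (h z.1 = h0 z.1); last by left.
  by right; split=> // gz; apply: ne; rewrite hz gz.
- rewrite (integralB mAB igD ihD) (integral_image measurable_snd rho_snd mB mg).
  rewrite (integral_image measurable_fst rho_fst mA mh) -setTX -setXT.
  (* The marginal integrals live on full strips; the part of each strip outside the rectangle is
     null and is removed. *)
  rewrite (negligible_integral _ mTB ig' plan_fstC0); last exact: measurableD.
  rewrite (negligible_integral _ mAT ih' plan_sndC0); last exact: measurableD.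
  by rewrite !setDD !setIidr.
Qed.

End plans.

(** * Optimality of the normalized part of an optimal plan *)

Section restriction.
Context d1 d2 (T : measurableType d1) (U : measurableType d2) (R : realType).
Variables (mu : probability T R) (nu : probability U R) (c : T * U -> R).
Hypothesis mc : measurable_fun setT (fun z => (c z)%:E).
Variables (a : T -> R) (b : U -> R).
Hypothesis a_L1 : mu.-integrable setT (fun x => (a x)%:E).
Hypothesis b_L1 : nu.-integrable setT (fun y => (b y)%:E).
Hypothesis c_ge : forall x y, (a x + b y <= c (x, y))%R.
Hypothesis C_fin : transport_cost mu nu setT setT c \is a fin_num.
Variable pi : probability (T * U)%type R.
Hypothesis pi_opt : optimal_plan mu nu setT setT c pi.
Variable pit : {measure set (T * U)%type -> \bar R}.
Hypothesis pit_le : forall E, measurable E -> pit E <= pi E.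
Hypothesis pit_gt0 : 0 < pit setT.
Variable pi' : probability (T * U)%type R.
Hypothesis pi'E : forall E, measurable E -> pi' E = ((fine (pit setT))^-1)%:E * pit E.
Variables (mu' : probability T R) (nu' : probability U R).
Hypothesis pi'_plan : plans mu' nu' pi'.

Let ma : measurable_fun setT (fun x => (a x)%:E). Proof. exact: measurable_int a_L1. Qed.
Let mb : measurable_fun setT (fun y => (b y)%:E). Proof. exact: measurable_int b_L1. Qed.

Let cost_integrable (rho : probability (T * U)%type R) :
  rho.-integrable setT (fun z => (a z.1)%:E) ->
  rho.-integrable setT (fun z => (b z.2)%:E) ->
  \int[rho]_z (c z)%:E < +oo -> rho.-integrable setT (fun z => (c z)%:E).
Proof.
move=> ia ib; apply: (integrable_lower_bound measurableT mc (integrableD measurableT ia ib)).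
by move=> [x y] _; rewrite -EFinD lee_fin.
Qed.

Let pi_plan : plans mu nu pi. Proof. by have [] := pi_opt. Qed.

Let pi_a : pi.-integrable setT (fun z => (a z.1)%:E).
Proof. by have := (plan_integrable_fst pi_plan measurableT ma).1 a_L1; rewrite setXTT. Qed.

Let pi_b : pi.-integrable setT (fun z => (b z.2)%:E).
Proof. by have := (plan_integrable_snd pi_plan measurableT mb).1 b_L1; rewrite setXTT. Qed.

Let pi_c : pi.-integrable setT (fun z => (c z)%:E).
Proof.
apply: cost_integrable => //; have [_ piC] := pi_opt.
by rewrite setXTT in piC; rewrite piC ltey_eq C_fin.
Qed.

Let pifin : pi setT < +oo. Proof. by rewrite probability_setT ltry. Qed.

Let zeta := fine (pit setT).

Let pit_fin : pit setT = zeta%:E.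
Proof. by rewrite /zeta fineK// ge0_fin_numE// (le_lt_trans (pit_le measurableT)). Qed.

Let zeta_gt0 : (0 < zeta)%R. Proof. by rewrite -lte_fin -pit_fin. Qed.

Let pi'_scale f : pi.-integrable setT f -> pi'.-integrable setT f /\
  \int[pi']_z f z = (zeta^-1)%:E * \int[pit]_z f z.
Proof.
move=> fi; have fit := integrable_measure_le pifin pit_le measurableT fi.
by apply: integrable_scale fit => //; rewrite invr_ge0 ltW.
Qed.

Lemma cost_integrable_restricted : pi'.-integrable setT (fun z => (c z)%:E).
Proof. by have [] := pi'_scale pi_c. Qed.

Lemma restricted_plan_le (rho : probability (T * U)%type R) : plans mu' nu' rho ->
  \int[pi']_z (c z)%:E <= \int[rho]_z (c z)%:E.
Proof.
(* If the competitor has cost below [+oo], then [c] is integrable against it: integrability of [a]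
   and [b] depends only on the marginals, which [rho] shares with [pi']. *)
move=> rho_plan; have [->|rho_lty] := eqVneq (\int[rho]_z (c z)%:E) +oo; first by rewrite leey.
have rho_c : rho.-integrable setT (fun z => (c z)%:E).
  have [pi'_a _] := pi'_scale pi_a; have [pi'_b _] := pi'_scale pi_b.
  apply: cost_integrable; last by rewrite ltey.
    have := plan_integrable_fst rho_plan measurableT ma.
    have := plan_integrable_fst pi'_plan measurableT ma.
    by rewrite setXTT => h1 h2; apply/h2/h1.
  have := plan_integrable_snd rho_plan measurableT mb.
  have := plan_integrable_snd pi'_plan measurableT mb.
  by rewrite setXTT => h1 h2; apply/h2/h1.
have [m mE] := measure_complement pifin pit_le.
have pit_c := integrable_measure_le pifin pit_le measurableT pi_c.
have m_c : m.-integrable setT (fun z => (c z)%:E).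
  apply: integrable_measure_le pifin _ measurableT pi_c => E mEE.
  by rewrite mE// leeDr.
(* The rest [m] of [pi] completed by [zeta] times the competitor: mass and marginals are those of
   [pi]. *)
pose s0 := measure_add m (mscale (NngNum (ltW zeta_gt0)) rho).
have s0E E : s0 E = m E + zeta%:E * rho E by rewrite /s0 measure_addE.
have s01 : s0 setT = 1.
  rewrite s0E probability_setT mule1 -pit_fin addeC -mE//; exact: probability_setT.
have [s ss0] := measure_probability s01.
have sE E : s E = m E + zeta%:E * rho E by rewrite ss0; exact: s0E.
have s_plan : plans mu nu s.
  split=> E mEE.
    have mET : measurable (E `*` [set: U]) by exact: measurableX.
    rewrite sE rho_plan.1// -pi'_plan.1// pi'E// muleA -EFinM -/zeta.
    rewrite divff ?gt_eqF// mul1e addeC -mE//; exact: pi_plan.1.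
  have mTE : measurable ([set: T] `*` E) by exact: measurableX.
  rewrite sE rho_plan.2// -pi'_plan.2// pi'E// muleA -EFinM -/zeta.
  rewrite divff ?gt_eqF// mul1e addeC -mE//; exact: pi_plan.2.
have [zrho_c zrhoE] := @integrable_scale _ _ _ rho
  (mscale (NngNum (ltW zeta_gt0)) rho) zeta setT _ (ltW zeta_gt0) measurableT
  (fun _ _ => erefl) rho_c.
have sc : \int[s]_z (c z)%:E = \int[m]_z (c z)%:E + zeta%:E * \int[rho]_z (c z)%:E.
  rewrite -zrhoE -(integral_measure_add measurableT m_c zrho_c).
  by apply: eq_measure_integral => E _ _; exact: ss0.
have pic : \int[pi]_z (c z)%:E = \int[pit]_z (c z)%:E + \int[m]_z (c z)%:E.
  rewrite -(integral_measure_add measurableT pit_c m_c).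
  apply: eq_measure_integral => E mEE _.
  by rewrite mE//; exact/esym/measure_addE.
(* Optimality of [pi] against [s]. All integrals are finite, so the contribution of [m] cancels and
   division by [zeta] concludes. *)
have : \int[pi]_z (c z)%:E <= \int[s]_z (c z)%:E.
  have [_ piC] := pi_opt; rewrite setXTT in piC; rewrite piC.
  by apply: ereal_inf_lbound; exists s => //; rewrite setXTT.
rewrite sc pic (pi'_scale pi_c).2.
have := integrable_fin_num measurableT pit_c; have := integrable_fin_num measurableT m_c.
have := integrable_fin_num measurableT rho_c.
case: (\int[pit]_z (c z)%:E) => // p; case: (\int[m]_z (c z)%:E) => // q.
case: (\int[rho]_z (c z)%:E) => // t _ _ _.
rewrite -!EFinM -!EFinD !lee_fin => h; rewrite mulrC ler_pdivrMr//; lra.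
Qed.

Variables (A : set T) (B : set U) (mA : measurable A) (mB : measurable B).
Hypotheses (A0 : mu' (~` A) = 0) (B0 : nu' (~` B) = 0).

Lemma transport_cost_restricted :
  transport_cost mu' nu' A B c = \int[pi']_(z in A `*` B) (c z)%:E.
Proof.
have mAB : measurable (A `*` B) by exact: measurableX.
apply/eqP; rewrite eq_le; apply/andP; split.
  by apply: ereal_inf_lbound; exists pi'.
apply: le_ereal_inf_tmp => _ [rho rho_plan <-].
rewrite (integral_full mAB (plan_full pi'_plan mA mB A0 B0) mc).
rewrite (integral_full mAB (plan_full rho_plan mA mB A0 B0) mc).
exact: restricted_plan_le.
Qed.

End restriction.

(** * Dual optimality from concentration on a subdifferential *)

Section solution.
Context d1 d2 (T : measurableType d1) (U : measurableType d2) (R : realType).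
Variables (mu : probability T R) (nu : probability U R) (c : T * U -> R).
Variables (A : set T) (B : set U) (mA : measurable A) (mB : measurable B).
Hypotheses (A0 : mu (~` A) = 0) (B0 : nu (~` B) = 0).
Variable pi : probability (T * U)%type R.
Hypothesis pi_opt : optimal_plan mu nu A B c pi.
Hypothesis pi_c : pi.-integrable (A `*` B) (fun z => (c z)%:E).
Variable h : T -> \bar R.
Hypothesis h_proper : proper_fun A h.
Hypothesis pi_h : concentrated pi (graph (subdiff A B (neg_cost c) h)).

Lemma concentrated_solves_dual : solves_dual mu nu A B c h.
Proof.
have [pi_plan piC] := pi_opt.
have mAB : measurable (A `*` B) by exact: measurableX.
have cC : has_integral pi (A `*` B) (fun z => (c z)%:E) (transport_cost mu nu A B c).
  exists (fun z => (c z)%:E); split=> //.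
  by apply: negligibleS (negligible_set0 _) => z [_].
have hc : pi.-negligible [set z | (A `*` B) z /\
    - ktransform A (neg_cost c) h z.2 - h z.1 <> (c z)%:E].
  apply: negligibleS pi_h => z [_ ne] /(subdiffP _ _ _ _ h_proper)[_ _ hfin hk].
  apply: ne; rewrite hk /neg_cost -surjective_pairing.
  by case: (h z.1) hfin => // r _; rewrite -!EFinN -!EFinD; congr EFin; lra.
have adm : dual_admissible A B c h (fun y => - ktransform A (neg_cost c) h y).
  split; first by case: h_proper.
    by move=> y _; have := ktransform_neqNy (neg_cost c) y h_proper;
       case: (ktransform A _ h y).
  move=> x y Ax By; have := ktransform_ge (neg_cost c) h y Ax.
  have := h_proper.1 _ Ax; rewrite /neg_cost.
  case: (h x) => [r| |] // _; last by move=> _; rewrite addeNy leNye.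
  case: (ktransform A _ h y) => [s| |] //; last by move=> _; rewrite /= addNye leNye.
  by rewrite -!EFinN -!EFinD !lee_fin => ?; lra.
split=> //.
  exists pi => //; have [c0 [ic0 cc0 <-]] := cC; exists c0; split=> //.
  apply: negligibleS (negligibleU hc cc0) => z [ABz ne].
  have [cz|] := pselect ((c z)%:E = c0 z); last by right.
  by left; split=> // e; apply: ne; rewrite e.
move=> u v hu hv.
have hvN := has_integralN mB hv.
(* Both sides are integrals against [pi] of functions that agree almost everywhere by [hc], so
   comparison applies in both directions. *)
have uv : - v - u = transport_cost mu nu A B c.
  have hI := plan_has_integral pi_plan mA mB A0 B0 hu hvN.
  apply/eqP; rewrite eq_le; apply/andP; split.
    apply: (has_integral_le mAB _ hI cC); apply: negligibleS hc => z [ABz ne].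
    by split=> // e; apply: ne; rewrite e.
  apply: (has_integral_le mAB _ cC hI); apply: negligibleS hc => z [ABz ne].
  by split=> // e; apply: ne; rewrite e.
split=> //; apply/eqP; rewrite eq_le; apply/andP; split.
  apply: ereal_sup_ubound.
  by exists h, (fun y => - ktransform A (neg_cost c) h y), u, (- v); split.
(* Weak duality: admissibility is integrated against [pi]. *)
apply: ge_ereal_sup => _ [h1 [g1 [u1 [v1 [[_ _ hg1] hu1 hv1 ->]]]]]; rewrite uv.
have gI := plan_has_integral pi_plan mA mB A0 B0 hu1 hv1.
apply: (has_integral_le mAB _ gI cC).
apply: negligibleS (negligible_set0 _) => -[x y] [[Ax By]] ; apply.
exact: hg1.
Qed.

End solution.

Lemma lower_semicontinuous_measurable_prod (R : realType) (X Y : ptopologicalType)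
    (f : X * Y -> \bar R) :
  @second_countable X -> @second_countable Y -> lower_semicontinuous f ->
  measurable_fun setT (f : borel X * borel Y -> \bar R).
Proof.
move=> cX cY /lower_semicontinuousP lf.
apply: (measurability _ (ErealGenOInfty.measurableE R)) => _ [_ [r ->] <-].
by rewrite setTI preimage_itvoy; apply: open_measurable_prod (lf r).
Qed.

Lemma concentratedS (R : realType) d (T : measurableType d)
    (m : {measure set T -> \bar R}) (E F : set T) :
  E `<=` F -> concentrated m E -> concentrated m F.
Proof. by move=> EF; apply: negligibleS; exact: subsetC. Qed.

(* Restricting [f] to [A] need not give a k-convex function; the transform
   over [B] of its k-transform agrees with [f] wherever [M] is defined. *)
Lemma antider_family_restriction (R : realType) (T U : Type) (A : set T) (B : set U)
    (k : T -> U -> R) (S : set T) (f : T -> \bar R) (M : T -> set U) :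
  proper_fun setT f -> graph M !=set0 ->
  graph M `<=` graph (subdiff setT setT k f) `&` (A `*` B) -> S `<=` mdom M ->
  antider_family A B k S f M !=set0.
Proof.
move=> fp [[x0 y0] M0] Mf SM; pose h := ktransform B (flip_kernel k) (ktransform setT k f).
have MfE x y : M x y -> [/\ A x, B y, f x \is a fin_num &
    ktransform setT k f y = (k x y)%:E - f x].
  move=> Mxy; have [/(subdiffP _ _ _ _ fp)[_ _ ? ?] [? ?]] := Mf _ (Mxy : graph M (x, y)).
  by [].
have hM x y : M x y -> h x = f x.
  move=> Mxy; have [Ax By fx fk] := MfE _ _ Mxy.
  apply/eqP; rewrite eq_le ktransformK_le//=.
  (* The term of the double transform at the subgradient [y] is already [f x]. *)
  have := ktransform_ge (flip_kernel k) (ktransform setT k f) x By; rewrite fk.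
  by rewrite /flip_kernel -(fineK fx) -!EFinB opprB addrC subrK.
have fkN y : ktransform setT k f y != -oo by exact: ktransform_neqNy.
exists h; split.
- split; last by exists (ktransform setT k f).
  split=> [x Ax|]; last first.
    have [Ax By fx _] := MfE _ _ M0.
    by exists x0; split=> //; rewrite (hM _ _ M0) ltey_eq fx.
  (* The transform of [f] is finite at [y0], whose term therefore keeps [h] above [-oo] at every
     point. *)
  have [_ By fx fk] := MfE _ _ M0.
  have := ktransform_ge (flip_kernel k) (ktransform setT k f) x By; rewrite fk.
  by rewrite -ltNye -(fineK fx) -!EFinB; apply: lt_le_trans; rewrite ltNyr.
- move=> [x y] Mxy; have [Ax By fx fk] := MfE _ _ Mxy; split=> // x' Ax' /=.
  have := ktransform_ge (flip_kernel k) (ktransform setT k f) x' By.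
  rewrite (hM _ _ Mxy) fk -/h /flip_kernel -(fineK fx).
  case: (h x') => [r| |] //; last by move=> _; rewrite addye// leey.
  by rewrite -!EFinB -!EFinD !lee_fin => ?; lra.
- by move=> s /SM[y] /hM.
Qed.

Theorem theorem3p5 (R : realType) (X Y : completePseudoMetricType R)
  (polX : polish X) (polY : polish Y)
  (mu : probability (borel X) R) (nu : probability (borel Y) R)
  (c : X * Y -> R)
  (c_lsc : lower_semicontinuous (fun z : X * Y => (c z)%:E))
  (a : X -> R) (b : Y -> R)
  (a_usc : upper_semicontinuous (fun x : X => (a x)%:E))
  (b_usc : upper_semicontinuous (fun y : Y => (b y)%:E))
  (a_L1 : mu.-integrable [set: borel X] (fun x => (a x)%:E))
  (b_L1 : nu.-integrable [set: borel Y] (fun y => (b y)%:E))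
  (c_ge : forall x y, (a x + b y <= c (x, y))%R)
  (C_fin : transport_cost mu nu setT setT c \is a fin_num)
  (pi : probability (borel X * borel Y)%type R)
  (pi_opt : optimal_plan mu nu setT setT c pi)
  (f : X -> \bar R)
  (f_convex : kconvex setT setT (neg_cost c) f)
  (pi_f : concentrated pi (graph (subdiff setT setT (neg_cost c) f)))
  (pit : {measure set (borel X * borel Y)%type -> \bar R})
  (pit_le : forall E, measurable E -> pit E <= pi E)
  (pit_gt0 : 0 < pit setT)
  (pi' : probability (borel X * borel Y)%type R)
  (pi'_def : forall E, measurable E ->
     pi' E = ((fine (pit setT))^-1)%:E * pit E)
  (mu' : probability (borel X) R) (nu' : probability (borel Y) R)
  (mu'_def : forall E, measurable E -> mu' E = pi' (E `*` [set: borel Y]))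
  (nu'_def : forall F, measurable F -> nu' F = pi' ([set: borel X] `*` F))
  (X' : set X) (Y' : set Y)
  (X'_closed : closed X') (X'_supp : msupport mu' `<=` X')
  (Y'_closed : closed Y') (Y'_supp : msupport nu' `<=` Y')
  (M : X -> set Y)
  (pi'_M : concentrated pi' (graph M))
  (M_f : graph M `<=`
     graph (subdiff setT setT (neg_cost c) f) `&` (X' `*` Y'))
  (S : set X) (S_neq0 : S !=set0) (S_dom : S `<=` mdom M) :
  let k := neg_cost c in
  let F := antider_family X' Y' k S f M in
  let alpha := lower_envelope F in
  let gamma := upper_envelope F in
  let alpha_dual := lower_envelope (antider_family Y' X' (flip_kernel k)
                      (mimage M S) (ktransform setT k f) (minv M)) in
  [/\ (forall f' : X -> \bar R, F f' <->
         [/\ kconvex X' Y' k f',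
             (forall s, S s -> f' s = f s) /\ concentrated mu' (effdom X' f'),
             antiderivative X' Y' k M f' /\
               concentrated pi' (graph (subdiff X' Y' k f')) &
             solves_dual mu' nu' X' Y' c f']),
      F !=set0,
      (F alpha /\ forall h, F h -> forall x, X' x -> alpha x <= h x) /\
      (F gamma /\ forall h, F h -> forall x, X' x -> h x <= gamma x),
      (forall x, X' x ->
         alpha x = ereal_sup [set f s + rockafellar k M s x | s in S]) &
      (forall y, Y' y -> ktransform X' k gamma y = alpha_dual y) /\
      (forall x, X' x -> gamma x = ktransform Y' (flip_kernel k) alpha_dual x)].
Proof.
move=> k F alpha gamma alpha_dual.
have cX := polish_second_countable polX; have cY := polish_second_countable polY.
have [fp _] := f_convex.
have [s0 Ss0] := S_neq0; have [y0 Ms0] := S_dom _ Ss0.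
have M0 : graph M !=set0 by exists (s0, y0).
have F0 : F !=set0 by exact: antider_family_restriction fp M0 M_f S_dom.
have Falpha : F alpha by exact: lower_envelope_antider_family.
have Fgamma : F gamma by exact: upper_envelope_antider_family.
have mX' : measurable (X' : set (borel X)) by exact: closed_measurable_borel.
have mY' : measurable (Y' : set (borel Y)) by exact: closed_measurable_borel.
have X'0 := msupport_negligible cX X'_closed X'_supp.
have Y'0 := msupport_negligible cY Y'_closed Y'_supp.
have mc := lower_semicontinuous_measurable_prod cX cY c_lsc.
have pi'_plan : plans mu' nu' pi'.
  by split=> E mE; [rewrite mu'_def|rewrite nu'_def].
have pi'_opt : optimal_plan mu' nu' X' Y' c pi'.
  split=> //; apply/esym.
  exact: (transport_cost_restricted mc a_L1 b_L1 c_ge C_fin pi_opt pit_le pit_gt0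
    pi'_def pi'_plan mX' mY' X'0 Y'0).
have pi'_c : pi'.-integrable (X' `*` Y') (fun z => (c z)%:E).
  apply: (integrableS measurableT _ (@subsetT _ _)); first exact: measurableX.
  exact: (cost_integrable_restricted mc a_L1 b_L1 c_ge C_fin pi_opt pit_le pit_gt0 pi'_def).
have g0E s y : S s -> M s y -> ktransform setT k f y = (k s y)%:E - f s.
  move=> _ Msy; have [fd _] := M_f _ (Msy : graph M (s, y)).
  by have /(subdiffP _ _ _ _ fp)[] := fd.
have gammaE y : Y' y -> ktransform X' k gamma y = alpha_dual y.
  exact: ktransform_upper_envelope.
split=> //.
(* Membership is contained in the listed properties; the work is to derive from it full measure of
   the effective domain, concentration and dual optimality. *)
- move=> f'; split=> [Ff'|[? [? _] [? _] _]]; last by split.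
  have [f'_convex f'_M f'_S] := Ff'.
  have pi'_f' : concentrated pi' (graph (subdiff X' Y' k f')) by exact: concentratedS pi'_M.
  split=> //.
  + split=> //; have [pi'X pi'Y] := pi'_plan.
    apply: concentratedS (concentrated_fst polX polY pi'X pi'Y pi'_M).
    move=> _ [[x y] Mxy <-]; have [Ax _ f'x _] := graph_antider_family Ff' Mxy.
    by split=> //=; rewrite ltey_eq f'x.
  + exact: (concentrated_solves_dual mX' mY' X'0 Y'0 pi'_opt pi'_c f'_convex.1 pi'_f').
- split; split=> // h Fh x _; first exact: lower_envelope_le.
  exact: upper_envelope_ge.
- by move=> x X'x; exact: lower_envelopeE.
- split=> // x X'x; have [gamma_convex _ _] := Fgamma.
  (* [gamma] is its own double transform, and its transform is [alpha_dual] on [Y']. *)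
  by rewrite -(kconvexK gamma_convex X'x); exact: eq_ktransform.
Qed.
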